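(* Let $\Delta$ be a Gorenstein* simplicial complex on $[n]$ with frame dimension $c-1$. Then there is a natural identification of the graded module $S(\Delta^* )$ with the ideal in $k[x_1,\dots,x_n]$ defining the Stanley-Reisner ring of the simplicial complex $\Delta^*$. (And so this ideal defines a subscheme of codimension $c+1$ in $\mathbf P^{n-1}$.)
   Context: $k$ is a field, $[n]=\{1,\dots,n\}$. A simplicial complex on a finite set is a family of subsets closed under taking subsets; the empty family and $\{\emptyset\}$ are both simplicial complexes. $d$ is the maximal cardinality of a face of $\Delta$. The frame dimension of a complex on $[n]$ is $c-1$, where $c\le n$ is the largest integer such that all $c$-subsets of $[n]$ are in it ($c=-1$ for the empty family). $\operatorname{lk}_\Delta S=\{F\subseteq[n]\setminus S:F\cup S\in\Delta\}$, and $\Delta^*=\{F\subseteq[n]:[n]\setminus F\notin\Delta\}$ is the Alexander dual. $\tilde H_*$ is reduced simplicial homology over $k$ ($\tilde H_{-1}(\{\emptyset\})=k$; the empty family has zero homology). $\Delta$ is Gorenstein* if $\tilde H_p(\operatorname{lk}_\Delta S)$ is $k$ when $p+|S|=d-1$ and $S$ is a face of $\Delta$, and is zero otherwise. The ideal defining the Stanley-Reisner ring of a simplicial complex $\Gamma$ on $[n]$ is the ideal of $k[x_1,\dots,x_n]$ generated by the monomials $\prod_{i\in F}x_i$ with $F\subseteq[n]$, $F\notin\Gamma$. $L(\Gamma)$, for $\Gamma$ a simplicial complex on $[n]$: the complex of free graded modules over $k[x_1,\dots,x_n]$ with term $\bigoplus_{I\in\Gamma,|I|=p}k[x_1,\dots,x_n]\,u_I$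 ($u_I$ of degree $p$) in cohomological degree $-p$ and differential $u_{\{i_1<\dots<i_p\}}\mapsto\sum_j(-1)^{j-1}x_{i_j}u_{\{i_1,\dots,i_p\}\setminus\{i_j\}}$. The module $S(\Delta^* )$ is the cohomology module $H^{-c^*}L(\Delta^* )$, where $c^*-1$ is the frame dimension of $\Delta^*$.
   Formalization: The formal theorem adds c+1 ≤ n−1, excluding only n = 0 and the boundary of the full simplex, where the claim fails: for that boundary, Δ* = {∅} and S(Δ* ) = k[x_1,…,x_n], but the ideal is (x_1,…,x_n). *)

(* Defs.v *)
From HB Require Import structures.
From mathcomp Require Import all_boot all_order all_algebra.
From mathcomp.classical Require Import boolp.
From mathcomp.multinomials Require Import mpoly.

Set Implicit Arguments.
Unset Strict Implicit.
Unset Printing Implicit Defensive.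

Import GRing.Theory.
Local Open Scope ring_scope.
Local Open Scope quotient_scope.

(* {quot N} from ring_quotient is only a zmodType; when N is closed under
   scaling we make it a module. *)
Section QuotientModule.
Variables (A : nzRingType) (M : lmodType A) (N : submodClosed M).

Fact submod_zmod_closed : zmod_closed N.
Proof. by split=> [|x y xN yN]; rewrite ?rpred0 // -scaleN1r rpredD ?rpredZ. Qed.

Definition submod_zmod : zmodClosed M :=
  HB.pack (GRing.SubmodClosed.sort N)
    (GRing.isZmodClosed.Build M (GRing.SubmodClosed.sort N) submod_zmod_closed).

Definition quot_mod : Type := Quotient.quot submod_zmod.
HB.instance Definition _ := GRing.Zmodule.on quot_mod.

Definition quot_pi (x : M) : quot_mod := \pi_(Quotient.quot submod_zmod) x.

Lemma quot_piE (x y : M) : (quot_pi x == quot_pi y) = (x - y \in N).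
Proof. exact: (esym (@Quotient.idealrBE _ submod_zmod x y)). Qed.

Lemma quot_pi_repr (x : quot_mod) :
  quot_pi (repr (x : Quotient.quot submod_zmod)) = x.
Proof. exact: reprK. Qed.

Lemma quot_piB : {morph quot_pi : x y / x - y}.
Proof. by move=> x y; rewrite /quot_pi raddfB. Qed.

Definition quot_scale (a : A) (x : quot_mod) : quot_mod :=
  quot_pi (a *: repr (x : Quotient.quot submod_zmod)).

Lemma quot_scale_pi a x : quot_scale a (quot_pi x) = quot_pi (a *: x).
Proof.
apply/eqP; rewrite quot_piE -scalerBr rpredZ //.
by rewrite -quot_piE quot_pi_repr.
Qed.

Lemma quot_piD : {morph quot_pi : x y / x + y}.
Proof. by move=> x y; rewrite /quot_pi raddfD. Qed.

Fact quot_scaleA a b x :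
  quot_scale a (quot_scale b x) = quot_scale (a * b) x.
Proof. by rewrite -[x]quot_pi_repr !quot_scale_pi scalerA. Qed.
Fact quot_scale1 : left_id 1 quot_scale.
Proof. by move=> x; rewrite -[x]quot_pi_repr quot_scale_pi scale1r. Qed.
Fact quot_scaleDr : right_distributive quot_scale +%R.
Proof.
move=> a x y; rewrite -[x]quot_pi_repr -[y]quot_pi_repr.
by rewrite -quot_piD !quot_scale_pi scalerDr quot_piD.
Qed.
Fact quot_scaleDl x : {morph quot_scale^~ x : a b / a + b}.
Proof.
by move=> a b; rewrite -[x]quot_pi_repr !quot_scale_pi scalerDl quot_piD.
Qed.

HB.instance Definition _ := GRing.Zmodule_isLmodule.Build A quot_mod
  quot_scaleA quot_scale1 quot_scaleDr quot_scaleDl.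

Fact quot_pi_is_linear : linear quot_pi.
Proof. by move=> a x y; rewrite quot_piD -quot_scale_pi. Qed.
HB.instance Definition _ := GRing.isLinear.Build A M quot_mod _ quot_pi
  quot_pi_is_linear.

End QuotientModule.

(* A family of subsets of [n] is a {set {set 'I_n}}; index i : 'I_n stands for
   the vertex i + 1. *)
Section Complexes.
Variable n : nat.
Implicit Type G : {set {set 'I_n}}.

Definition simplicial_complex G : Prop :=
  forall F F' : {set 'I_n}, F \in G -> F' \subset F -> F' \in G.

Definition link G (S : {set 'I_n}) : {set {set 'I_n}} :=
  [set F : {set 'I_n} | (F \subset ~: S) && (F :|: S \in G)].

Definition alexander_dual G : {set {set 'I_n}} :=
  [set F : {set 'I_n} | ~: F \notin G].

Definition max_face_card G : nat := \max_(F in G) #|F|.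

(* The maximum ranges over m = c + 1, so that c = -1 (m = 0) is included, and
   the frame dimension is c - 1 = m - 2. *)
Definition frame_dim G : int :=
  (\max_(m < n.+2 | [forall F : {set 'I_n}, (#|F|.+1 == m) ==> (F \in G)])
     m)%:Z - 2%:Z.

End Complexes.

(* The complex of free A-modules with basis elements u_I (I in G) in homological
   degree #|I|, and differential
     u_I |-> \sum_(i in I) (-1) ^ #{j in I | j < i} w_i u_(I \ i).
   For w = 1 it is the augmented simplicial chain complex (shifted by one), for
   A = k[x_1,...,x_n] and w_i = x_i it is L(G). *)
Section WeightedComplex.
Variables (n : nat) (A : comNzRingType) (w : 'I_n -> A).
Variable G : {set {set 'I_n}}.
Implicit Types p q : int.

Definition face p : Type :=
  {I : {set 'I_n} | (I \in G) && (#|I|%:Z == p)}.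
HB.instance Definition _ p := Finite.on (face p).

Definition chain p : Type := {ffun face p -> A^o}.
HB.instance Definition _ p := GRing.Lmodule.on (chain p).

(* Taking p and q as independent parameters avoids casts along p + 1 - 1 = p;
   only q = p - 1 is used (otherwise the map is zero). *)
Definition bnd p q (z : chain p) : chain q :=
  [ffun J : face q =>
    \sum_(I : face p) \sum_(i in val I | val I :\ i == val J)
      (-1) ^+ #|[set j in val I | (j < i)%N]| * w i * (z I : A)].

Fact bnd_is_linear p q : linear (@bnd p q).
Proof.
move=> a x y; apply/ffunP => J; rewrite !ffunE /= scaler_sumr -big_split /=.
apply: eq_bigr => I _; rewrite scaler_sumr -big_split /=.
apply: eq_bigr => i _; rewrite !ffunE mulrDr; congr (_ + _).
by rewrite /GRing.scale /= mulrCA.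
Qed.
HB.instance Definition _ p q := GRing.isLinear.Build A (chain p) (chain q) _
  (@bnd p q) (@bnd_is_linear p q).

Definition is_cycle p : {pred chain p} := fun z => bnd (p - 1) z == 0.

Fact is_cycle_submod p : submod_closed (@is_cycle p).
Proof.
split=> [|a x y]; first by rewrite unfold_in raddf0.
move=> /eqP xc /eqP yc; apply/eqP.
have := bnd_is_linear (p - 1) a x y; rewrite xc yc scaler0 addr0; exact.
Qed.
HB.instance Definition _ p := GRing.isSubmodClosed.Build A (chain p)
  (@is_cycle p) (@is_cycle_submod p).

Record chain_cycle p : Type :=
  ChainCycle { cycle_val : chain p; _ : is_cycle cycle_val }.
HB.instance Definition _ p := [isSub for @cycle_val p].
HB.instance Definition _ p := [Choice of chain_cycle p by <:].
HB.instance Definition _ p := [SubChoice_isSubLmodule of chain_cycle p by <:].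

Definition is_boundary p : {pred chain_cycle p} :=
  fun z => `[< exists y : chain (p + 1), bnd p y = val z >].

Fact is_boundary_submod p : submod_closed (@is_boundary p).
Proof.
split=> [|a x y]; first by apply/asboolP; exists 0; rewrite !raddf0.
move=> /asboolP[x' xE] /asboolP[y' yE]; apply/asboolP.
by exists (a *: x' + y'); rewrite bnd_is_linear xE yE.
Qed.
HB.instance Definition _ p := GRing.isSubmodClosed.Build A (chain_cycle p)
  (@is_boundary p) (@is_boundary_submod p).

Definition homology p : Type := quot_mod (@is_boundary p).
HB.instance Definition _ p := GRing.Lmodule.on (homology p).

Definition hclass p (z : chain_cycle p) : homology p :=
  quot_pi (@is_boundary p) z.

End WeightedComplex.

Definition reduced_homology (k : fieldType) n (G : {set {set 'I_n}}) (p : int) :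
  lmodType k := homology (fun _ : 'I_n => 1 : k) G (p + 1).

Definition gorenstein_star (k : fieldType) n (D : {set {set 'I_n}}) : Prop :=
  forall (S : {set 'I_n}) (p : int),
    let H := reduced_homology k (link D S) p in
    if (p + #|S|%:Z == (max_face_card D)%:Z - 1) && (S \in D)
    then exists f : {linear H -> k^o}, bijective f
    else forall x : H, x = 0.

Section EnrichedModule.
Variables (k : fieldType) (n : nat) (G : {set {set 'I_n}}).
Local Notation R := {mpoly k[n]}.

(* H^{-p} L(G) *)
Definition homologyL (p : int) : lmodType R :=
  homology (fun i : 'I_n => 'X_i : R) G p.

Definition moduleS : lmodType R := homologyL (frame_dim G + 1).

Definition homog_chainL (p : int) (e : nat) (z : chain R G p) : Prop :=
  forall (I : face G p) (m : 'X_{1..n}),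
    m \in msupp (z I : R) -> (mdeg m + #|val I|)%N = e.

Definition homog_moduleS (e : nat) (x : moduleS) : Prop :=
  exists z : chain_cycle (fun i : 'I_n => 'X_i : R) G (frame_dim G + 1),
    homog_chainL e (val z) /\ hclass z = x.

Definition SR_ideal (f : R) : Prop :=
  exists g : {set 'I_n} -> R,
    f = \sum_(F : {set 'I_n} | F \notin G) g F * \prod_(i in F) 'X_i.

Definition graded_iso_moduleS_SR (f : {linear moduleS -> R^o}) : Prop :=
  [/\ injective f,
      forall g : R, SR_ideal g <-> exists x, f x = g
    & forall (e : nat) (x : moduleS),
        homog_moduleS e x <-> (f x : R) \is e.-homog].

End EnrichedModule.

(* Points of P^{n-1} = Proj k[x_1,...,x_n]. *)
Section Codimension.
Variables (k : fieldType) (n : nat).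
Local Notation R := {mpoly k[n]}.
Implicit Types (P Q : {pred R}) (J : R -> Prop).

Definition proj_point P : Prop :=
  [/\ idealr_closed P, prime_idealr_closed P,
      forall (d : nat) (f : R), f \in P -> pihomog mdeg d f \in P
    & exists i : 'I_n, 'X_i \notin P].

Definition proper_sub P Q : Prop :=
  {subset P <= Q} /\ exists2 f, f \in Q & f \notin P.

(* Chains of irreducible closed subsets
   V(Q) = V(P_r) < ... < V(P_1) < V(P_0) of P^{n-1}. *)
Definition chain_below Q (r : nat) : Prop :=
  exists P : nat -> {pred R},
    [/\ forall i, (i <= r)%N -> proj_point (P i),
        forall i, (i < r)%N -> proper_sub (P i) (P i.+1)
      & P r =i Q].

Definition contains J Q : Prop := forall f, J f -> f \in Q.

(* The subscheme Proj(R / J) is nonempty, and the infimum over the irreducible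
   closed subsets V(Q) of it of the codimensions of V(Q) in P^{n-1} is e. *)
Definition proj_codim J (e : nat) : Prop :=
  (forall Q, proj_point Q -> contains J Q -> chain_below Q e) /\
  (exists Q, [/\ proj_point Q, contains J Q
    & forall r, chain_below Q r -> (r <= e)%N]).

End Codimension.

(* Main.v *)
(** Let G be the Alexander dual of D, and d - 1 the dimension of D.  In
    multidegree b, with support B, the complex L(G) is the augmented chain
    complex of the restriction of G to B, so everything reduces to simplicial
    homology over k.  The orientation cycle eps of D gives, by complementation,
    a cocycle eta of the full simplex which vanishes on G; writing eta as the
    coboundary of zeta, the restriction of zeta to G is a cocycle and the
    isomorphism is  z |-> sum_I zeta_I x^I z_I.  By Alexander duality inside B
    the homology of G|B is that of the link of the complement of B in D: it is
    zero for B in G, and one-dimensional and detected by zeta otherwise, because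
    every coefficient of eps on a facet is nonzero.  These B are exactly the
    supports of the monomials of the Stanley-Reisner ideal.

    An automorphism w/u of this ideal, with u = x_1 ... x_n, satisfies
    w^2 = u w' with w' in the ideal, so every x_i divides w and w/u is a scalar.

    For the codimension, a homogeneous prime over the ideal contains the
    variables of a nonface of D, hence of at least c + 1 of them; and
    k[x_1, ..., x_n] has no chain of primes of length n + 1. *)

Require Import Defs.
From HB Require Import structures.
From mathcomp Require Import all_boot all_order all_algebra.
From mathcomp.classical Require Import boolp.
From mathcomp.multinomials Require Import mpoly.
From mathcomp Require Import zify.
Set Implicit Arguments.
Unset Strict Implicit.
Unset Printing Implicit Defensive.
Import GRing.Theory.
Local Open Scope ring_scope.

(** * Chains indexed by all subsets *)

Section SetChains.
Variables (n : nat) (A : comNzRingType).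
Implicit Types (i j v : 'I_n) (I J K : {set 'I_n}) (y z : {set 'I_n} -> A).

Definition sgn i J : A := (-1) ^+ #|[set j in J | (j < i)%N]|.

(** Chains are functions on all subsets, so that support conditions replace the dependent index of
    [chain]. *)
Definition sbnd (w : 'I_n -> A) y J : A :=
  \sum_(i | i \notin J) sgn i J * w i * y (i |: J).

Definition cobnd y I : A := \sum_(i in I) sgn i I * y (I :\ i).

Lemma sgnU1 i J : sgn i (i |: J) = sgn i J.
Proof.
congr (_ ^+ #|pred_of_set _|); apply/setP=> j; rewrite !inE.
by case: eqP => // ->; rewrite ltnn !andbF.
Qed.

Lemma sgnD1 i J : sgn i (J :\ i) = sgn i J.
Proof.
congr (_ ^+ #|pred_of_set _|); apply/setP=> j; rewrite !inE.
by case: eqP => // ->; rewrite ltnn !andbF.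
Qed.

Lemma sgn_sqr i J : sgn i J * sgn i J = 1.
Proof. by rewrite -expr2 sqrr_sign. Qed.

Lemma sgnU i J K : [disjoint J & K] -> sgn i (J :|: K) = sgn i J * sgn i K.
Proof.
move=> dJK; rewrite -exprD -cardsUI.
rewrite (_ : _ :&: _ = set0) ?cards0 ?addn0; last first.
  apply/setP=> j; rewrite !inE.
  by have [jJ|] := boolP (j \in J) => //; rewrite (disjointFr dJK jJ) andbF.
by congr (_ ^+ #|pred_of_set _|); apply/setP=> j; rewrite !inE andb_orl.
Qed.

Lemma sgn1 i v : sgn i [set v] = (-1) ^+ (v < i)%N.
Proof.
congr (_ ^+ _); case: ltnP => vi.
  rewrite (_ : [set _ in _ | _] = [set v]) ?cards1 //.
  by apply/setP=> j; rewrite !inE; case: eqP => // ->.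
rewrite (_ : [set _ in _ | _] = set0) ?cards0 //.
apply/setP=> j; rewrite !inE; case: eqP => // ->; by rewrite ltnNge vi.
Qed.

Lemma sgn1_swap i v : i != v -> sgn i [set v] = - sgn v [set i].
Proof.
move=> iv; rewrite !sgn1.
by case: ltngtP iv => [||/val_inj->]; rewrite ?expr0 ?expr1 ?opprK ?eqxx.
Qed.

Lemma sgn_swap i v J : i != v -> i \notin J -> v \notin J ->
  sgn i J * sgn v (i |: J) = - (sgn v J * sgn i (v |: J)).
Proof.
move=> iv iJ vJ; rewrite !sgnU ?disjoints1 // sgn1_swap 1?eq_sym //.
by rewrite mulNr mulrN [sgn i J * _]mulrCA [sgn v J * _]mulrCA [sgn v J * _]mulrC.
Qed.

(** J and its complement together contain each of the i indices below i once. *)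
Lemma sgn_compl i J : sgn i J * sgn i (~: J) = (-1) ^+ i.
Proof.
rewrite -sgnU ?setUCr; last by rewrite -setI_eq0 setICr.
congr (_ ^+ _); rewrite -[RHS]card_ord.
rewrite -(card_image (f := widen_ord (ltnW (ltn_ord i)))); last first.
  by move=> a b /(congr1 val) /= /val_inj.
apply: eq_card => j; rewrite !inE /=; apply/idP/imageP => [ji|[a _ ->]].
  by exists (Ordinal ji) => //; apply: val_inj.
by have:= ltn_ord a.
Qed.

Lemma sum_incidence (F : 'I_n -> {set 'I_n} -> {set 'I_n} -> A) :
  \sum_(J : {set 'I_n}) \sum_(i | i \notin J) F i J (i |: J) =
  \sum_(I : {set 'I_n}) \sum_(i in I) F i (I :\ i) I.
Proof.
rewrite (exchange_big_dep xpredT) //= [RHS](exchange_big_dep xpredT) //=.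
apply: eq_bigr => i _.
rewrite [RHS](reindex_onto (fun J => i |: J) (fun I => I :\ i)) /=; last first.
  by move=> I iI; rewrite setD1K.
apply: eq_big => [J|J iJ]; last by rewrite setU1K.
rewrite setU11 /=; apply/idP/eqP => [iJ|<-]; first by rewrite setU1K.
by rewrite !inE eqxx.
Qed.

Lemma cobnd_adj x y :
  \sum_J x J * sbnd (fun=> 1) y J = \sum_I cobnd x I * y I.
Proof.
under eq_bigr do rewrite mulr_sumr.
under [RHS]eq_bigr do rewrite mulr_suml.
rewrite (sum_incidence (fun i J I => x J * (sgn i J * 1 * y I))).
apply: eq_bigr => I _; apply: eq_bigr => i _.
by rewrite sgnD1 mulr1 mulrCA mulrA.
Qed.

(** The terms (a, b) and (b, a) cancel, [lt] choosing one of each pair; comparing the sum with its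
    own negative would fail in characteristic 2. *)
Lemma sum_antisym (T : finType) (lt : rel T) (P : pred T) (F : T -> T -> A) :
  (forall a b, a != b -> lt a b = ~~ lt b a) ->
  (forall a b, a != b -> F a b = - F b a) ->
  \sum_(a | P a) \sum_(b | P b && (b != a)) F a b = 0.
Proof.
move=> ltN FN.
have -> : \sum_(a | P a) \sum_(b | P b && (b != a)) F a b =
  \sum_(a | P a) \sum_(b | P b && (b != a) && lt b a) F a b +
  \sum_(a | P a) \sum_(b | P b && (b != a) && ~~ lt b a) F a b.
  by rewrite -big_split; apply: eq_bigr => a _; rewrite (bigID (lt^~ a)).
rewrite [X in _ + X](exchange_big_dep P) /=; last first.
  by move=> a b _ /andP[/andP[]].
rewrite -big_split big1 // => a Pa; rewrite /=.
have -> : \sum_(b | P b && (P a && (a != b) && ~~ lt a b)) F b a =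
          \sum_(b | P b && (b != a) && lt b a) F b a.
  apply: eq_bigl => b; rewrite Pa eq_sym /= andbA.
  by have [->|ba] := eqVneq b a; rewrite ?andbF //= -ltN.
rewrite -big_split big1 // => b /andP[/andP[_ ba] _] /=.
by rewrite FN 1?eq_sym // addNr.
Qed.

Lemma sbnd_sbnd w y J : sbnd w (sbnd w y) J = 0.
Proof.
rewrite /sbnd; under eq_bigr do rewrite mulr_sumr.
pose F (i v : 'I_n) := sgn i J * sgn v (i |: J) * (w i * w v * y (v |: (i |: J))).
(* The indicator makes the summand antisymmetric for all i != v, as [sum_antisym] asks, and equals 1
   on the range of summation. *)
transitivity (\sum_(i | i \notin J) \sum_(v | (v \notin J) && (v != i))
    F i v *+ ((i \notin J) && (v \notin J))).
  apply: eq_bigr => i iJ; apply: eq_big => [v|v].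
    by rewrite !inE negb_or andbC.
  rewrite !inE negb_or iJ => /andP[_ vJ]; rewrite vJ mulr1n /F.
  by rewrite !mulrA; congr (_ * _); rewrite -!mulrA; congr (_ * _); rewrite mulrCA.
apply: (sum_antisym (lt := fun a b : 'I_n => (a < b)%N)) => a b ab.
  by rewrite -leqNgt [RHS]leq_eqVlt (inj_eq val_inj a b) (negPf ab).
rewrite andbC; case: (boolP (_ && _)) => [/andP[bJ aJ]|_]; last first.
  by rewrite !mulr0n oppr0.
by rewrite !mulr1n /F -mulNr -sgn_swap // [w a * _]mulrC setUCA.
Qed.

Definition cone v y I : A := if v \in I then sgn v I * y (I :\ v) else 0.

(** Contracting homotopy. For v in J, adding v in the second summand gives y J and the other terms
    cancel; for v outside J, only adding v in the first summand contributes. *)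
Lemma cone_bnd v y J :
  sbnd (fun=> 1) (cone v y) J + cone v (sbnd (fun=> 1) y) J = y J.
Proof.
rewrite /sbnd /cone; have [vJ|vJ] := boolP (v \in J).
  rewrite mulr_sumr (bigD1 (P := fun i => i \notin J :\ v) v) /=; last first.
    by rewrite !inE eqxx.
  rewrite addrCA mulr1 sgnD1 setD1K // mulrA sgn_sqr mul1r.
  rewrite -[RHS]addr0; congr (_ + _).
  rewrite [X in _ + X](eq_bigl (fun i => i \notin J)); last first.
    move=> i; rewrite !inE negb_and negbK.
    by have [->|] := eqVneq i v; rewrite ?vJ //= ?andbT.
  rewrite -big_split big1 // => i iJ /=; rewrite !inE vJ orbT !mulr1.
  have iv : i != v by apply: contraNneq iJ => ->.
  have vK : v \notin J :\ v by rewrite !inE eqxx.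
  have iK : i \notin J :\ v by rewrite !inE (negPf iJ) andbF.
  have := setD1K vJ; move: (J :\ v) vK iK => K vK iK <-.
  have vK' : v \notin i |: K by rewrite !inE eq_sym (negPf iv).
  rewrite setUCA setU1K // sgnU1.
  have vv : sgn v [set v] = 1 by rewrite sgn1 ltnn.
  rewrite !sgnU ?disjoints1 // sgn1_swap // vv mul1r !mulNr !mulrA.
  rewrite -[_ * sgn v [set i]]mulrA [sgn i K * _]mulrC mulrA sgn_sqr mul1r.
  by rewrite [sgn i K * _]mulrC addNr.
rewrite addr0 (bigD1 v) //= setU11 sgnU1 mulr1 setU1K // mulrA sgn_sqr mul1r.
rewrite big1 ?addr0 // => i /andP[iJ iv].
by rewrite !inE eq_sym (negPf iv) (negPf vJ) mulr0.
Qed.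

Lemma sbndB w x y J : sbnd w (fun I => x I - y I) J = sbnd w x J - sbnd w y J.
Proof. by rewrite /sbnd -sumrB; apply: eq_bigr => i _; rewrite mulrBr. Qed.

Lemma sbndZ w a y J : sbnd w (fun I => a * y I) J = a * sbnd w y J.
Proof.
by rewrite /sbnd mulr_sumr; apply: eq_bigr => i _; rewrite [RHS]mulrCA !mulrA.
Qed.

Lemma eq_sbnd w x y : x =1 y -> sbnd w x =1 sbnd w y.
Proof. by move=> E J; apply: eq_bigr => i _; rewrite E. Qed.

Lemma sbnd_expand w y J :
  sbnd w y J = \sum_F y F * sbnd w (fun K => (K == F)%:R) J.
Proof.
rewrite /sbnd; under [RHS]eq_bigr do rewrite mulr_sumr.
rewrite [RHS]exchange_big; apply: eq_bigr => i _ /=.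
rewrite (bigD1 (i |: J)) //= eqxx mulr1 mulrC big1 ?addr0 // => F.
by rewrite eq_sym => /negPf->; rewrite !mulr0.
Qed.

(** The full simplex is a cone with apex v. Here [zeta] is the transpose of the cone operator
    applied to [eta], and the transposed homotopy formula gives its coboundary. *)
Lemma cobnd_exact v eta : (forall I, cobnd eta I = 0) ->
  exists zeta, cobnd zeta =1 eta.
Proof.
move=> eta0; pose zeta J := if v \in J then 0 else sgn v J * eta (v |: J).
have pair x : \sum_J zeta J * x J = \sum_I eta I * cone v x I.
  rewrite [LHS](bigID (fun J => v \in J)) [RHS](bigID (fun J => v \notin J)) /=.
  rewrite [X in X + _]big1 => [|J vJ]; last by rewrite /zeta vJ mul0r.
  rewrite [X in _ = X + _]big1 => [|J vJ]; last by rewrite /cone (negPf vJ) mulr0.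
  congr (_ + _); rewrite [RHS](reindex_onto (fun J => v |: J) (fun I => I :\ v)) /=.
    apply: eq_big => [J|J vJ].
      rewrite setU11 /=; apply/idP/eqP => [vJ|<-]; first by rewrite setU1K.
      by rewrite !inE eqxx.
    by rewrite /zeta /cone (negPf vJ) setU11 setU1K // sgnU1 mulrCA mulrA.
  by move=> I; rewrite negbK => vI; rewrite setD1K.
exists zeta => I; have ind x : \sum_J x J * (J == I)%:R = x I.
  by rewrite (bigD1 I) //= eqxx mulr1 big1 ?addr0 // => J /negPf->; rewrite mulr0.
rewrite -[LHS]ind -cobnd_adj pair.
pose cI := cone v (fun J => (J == I)%:R).
under eq_bigr => J _ do rewrite
  -[cone _ _ _](addKr (sbnd (fun=> 1) cI J)) cone_bnd mulrDr mulrN.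
rewrite big_split /= ind sumrN cobnd_adj big1 ?oppr0 ?add0r // => J _.
by rewrite eta0 mul0r.
Qed.

End SetChains.

(** * Homology of the weighted complex in terms of functions on all subsets *)

Section Translation.
Variables (n : nat) (A : comNzRingType) (w : 'I_n -> A).
Variable G : {set {set 'I_n}}.
Implicit Types (i : 'I_n) (I J : {set 'I_n}) (y : {set 'I_n} -> A) (p q : int).

Definition supp_on p y : Prop :=
  forall I, y I != 0 -> I \in G /\ #|I|%:Z = p.

(** The sum has at most one term; it avoids deciding whether I belongs to [face G p]. *)
Definition ext p (z : chain A G p) I : A :=
  \sum_(I' : face G p | val I' == I) z I'.

Definition restr p y : chain A G p := [ffun I : face G p => y (val I)].

Lemma ext_val p (z : chain A G p) (I : face G p) : ext z (val I) = z I.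
Proof. by rewrite /ext (eq_bigl (pred1 I)) ?big_pred1_eq. Qed.

Lemma ext_supp p (z : chain A G p) : supp_on p (ext z).
Proof.
move=> I; have [I' /eqP<- _|noI] := pickP (fun I' : face G p => val I' == I).
  by have /andP[GI /eqP cI] := valP I'.
by rewrite /ext big_pred0 // eqxx.
Qed.

Lemma ext_restr p y : supp_on p y -> ext (restr p y) =1 y.
Proof.
move=> sy I; have [|nI] := boolP ((I \in G) && (#|I|%:Z == p)).
  by move=> PI; rewrite -[I]/(val (exist _ I PI : face G p)) ext_val ffunE.
rewrite /ext big_pred0 => [|I']; last first.
  by apply: contraNF nI => /eqP<-; exact: valP I'.
by apply/esym/eqP; apply: contraNT nI => /sy[-> ->]; rewrite eqxx.
Qed.

Lemma bndE p q (z : chain A G p) (J : face G q) :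
  bnd w q z J = sbnd w (ext z) (val J).
Proof.
rewrite ffunE (exchange_big_dep xpredT) //= /sbnd [RHS]big_mkcond.
apply: eq_bigr => i _ /=; case: ifPn => iJ; last first.
  rewrite big_pred0 // => I; apply: contraNF iJ => /andP[iI /eqP<-].
  by rewrite !inE eqxx.
rewrite /ext mulr_sumr; apply: eq_big => [I|I /andP[iI /eqP<-]].
  apply/andP/eqP => [[iI /eqP<-]|->]; first by rewrite setD1K.
  by rewrite setU11 setU1K.
by rewrite -/(sgn A i (val I)) -sgnD1.
Qed.

Hypothesis Gs : simplicial_complex G.

Lemma sbnd_supp p y : supp_on p y -> supp_on (p - 1) (sbnd w y).
Proof.
move=> sy J nz; have [i iJ] : exists2 i, i \notin J & y (i |: J) != 0.
  apply/exists_inP; apply: contraNT nz; rewrite negb_exists_in => /forall_inP y0.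
  rewrite /sbnd big1 // => i iJ.
  by have := y0 i iJ; rewrite negbK => /eqP->; rewrite mulr0.
move=> /sy[GJ <-]; split; first exact: Gs GJ (subsetUr _ _).
by rewrite cardsU1 iJ addnC PoszD addrK.
Qed.

Lemma ext_bnd p q (z : chain A G p) : q = p - 1 ->
  ext (bnd w q z) =1 sbnd w (ext z).
Proof.
move=> qE; rewrite (_ : bnd _ _ _ = restr q (sbnd w (ext z))); last first.
  by apply/ffunP=> J; rewrite bndE ffunE.
by rewrite qE; exact/ext_restr/sbnd_supp/ext_supp.
Qed.

Lemma is_cycleP p (z : chain A G p) :
  is_cycle w z <-> forall J, sbnd w (ext z) J = 0.
Proof.
split=> [/eqP z0 J|z0].
  by rewrite -(ext_bnd z erefl) z0 /ext big1 // => I _; rewrite ffunE.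
by apply/eqP/ffunP=> J; rewrite bndE z0 ffunE.
Qed.

Lemma cycle_ext p (z : chain_cycle w G p) J : sbnd w (ext (val z)) J = 0.
Proof. by move: J; apply/is_cycleP; exact: (valP z). Qed.

Lemma cycle_restr p y : supp_on p y -> (forall J, sbnd w y J = 0) ->
  exists z : chain_cycle w G p, ext (val z) =1 y.
Proof.
move=> sy y0; have cy : is_cycle w (restr p y).
  by apply/is_cycleP=> J; rewrite -[RHS](y0 J); apply: eq_sbnd; exact: ext_restr.
by exists (ChainCycle cy); exact: ext_restr.
Qed.

Lemma boundaryP p (z : chain_cycle w G p) :
  z \in @is_boundary _ _ w G p <->
  exists2 y, supp_on (p + 1) y & sbnd w y =1 ext (val z).
Proof.
rewrite unfold_in; split=> [/asboolP[y yE]|[y sy yE]].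
  exists (ext y); first exact: ext_supp.
  by move=> J; rewrite -yE ext_bnd ?addrK.
apply/asboolP; exists (restr (p + 1) y); apply/ffunP=> J.
rewrite bndE -ext_val -yE /sbnd; apply: eq_bigr => i _; by rewrite ext_restr.
Qed.

Lemma hclass_eq p (z z' : chain_cycle w G p) :
  hclass z = hclass z' <->
  exists2 y, supp_on (p + 1) y & forall J, sbnd w y J = ext (val z) J - ext (val z') J.
Proof.
have extB J : ext (val (z - z')) J = ext (val z) J - ext (val z') J.
  by rewrite /ext -sumrB; apply: eq_bigr => I _; rewrite !ffunE.
have -> : (hclass z = hclass z') <-> (z - z' \in @is_boundary _ _ w G p).
  by rewrite -quot_piE; split=> /eqP.
by rewrite boundaryP; split=> -[y sy yE]; exists y => // J; rewrite yE extB.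
Qed.

Lemma ext_cycle0 p J : ext (val (0 : chain_cycle w G p)) J = 0.
Proof. by rewrite /ext big1 // => I _; rewrite ffunE. Qed.

Lemma hclassZ p a (z : chain_cycle w G p) : hclass (a *: z) = a *: hclass z.
Proof. exact: linearZ. Qed.

Lemma hclass0 p : hclass (0 : chain_cycle w G p) = 0.
Proof. exact: raddf0. Qed.

Lemma hclass_surj p (x : homology w G p) : exists z, hclass z = x.
Proof. by eexists; exact: quot_pi_repr. Qed.

End Translation.

(** * Linear maps out of a quotient module *)

Section QuotientLift.
Variables (A : nzRingType) (M V : lmodType A) (N : submodClosed M).
Variable L : {linear M -> V}.
Hypothesis L0 : forall x, x \in N -> L x = 0.

Definition quot_lift (x : quot_mod N) : V := L (repr (x : Quotient.quot (submod_zmod N))).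

Lemma quot_lift_pi x : quot_lift (quot_pi N x) = L x.
Proof.
have /L0/eqP : repr (quot_pi N x : Quotient.quot (submod_zmod N)) - x \in N.
  by rewrite -quot_piE quot_pi_repr.
by rewrite raddfB subr_eq0 => /eqP.
Qed.

Lemma quot_lift_is_linear : linear quot_lift.
Proof.
move=> a x y; rewrite -[x]quot_pi_repr -[y]quot_pi_repr -linearP.
by rewrite !quot_lift_pi linearP.
Qed.

Lemma quot_liftP : exists f : {linear quot_mod N -> V},
  forall x, f (quot_pi N x) = L x.
Proof.
pose m := GRing.isLinear.Build A (quot_mod N) V _ quot_lift quot_lift_is_linear.
pose f : {linear quot_mod N -> V} := HB.pack quot_lift m.
by exists f => x; exact: quot_lift_pi.
Qed.
End QuotientLift.

(** * Cycles relative to a face *)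

Lemma setDUK (T : finType) (A B : {set T}) : B \subset A -> A :\: B :|: B = A.
Proof. by move=> BA; rewrite setUC -{1}(setIidPr BA) setID. Qed.

Section RelativeCycles.
Variables (k : fieldType) (n : nat) (D : {set {set 'I_n}}).
Hypothesis Dc : simplicial_complex D.
Implicit Types (i : 'I_n) (S I J F : {set 'I_n}) (y z : {set 'I_n} -> k) (p q : int).

Notation bd := (sbnd (fun=> 1)).

(* Chains of the link of S are written on the faces containing S, and their
   boundary is only tested there: passing to a larger S then needs no signs. *)
Definition rel_supp S p y : Prop :=
  forall F, y F != 0 -> [/\ F \in D, S \subset F & #|F|%:Z = p].

Definition rel_cycle S p y : Prop :=
  rel_supp S p y /\ forall J, S \subset J -> bd y J = 0.

(** The signs by which boundary coefficients at I |: S differ from those at I; they make [to_link]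
    commute with boundaries. *)
Definition link_sgn S I : k := \prod_(i in I) sgn k i S.

Definition to_link S y I : k :=
  if [disjoint I & S] then link_sgn S I * y (I :|: S) else 0.

Definition of_link S z F : k :=
  if S \subset F then link_sgn S (F :\: S) * z (F :\: S) else 0.

Lemma link_sgn_sqr S I : link_sgn S I * link_sgn S I = 1.
Proof. by rewrite -big_split big1 // => i _; exact: sgn_sqr. Qed.

Lemma link_complex S : simplicial_complex (link D S).
Proof.
move=> F F'; rewrite !inE => /andP[sF DF] F'F.
by rewrite (subset_trans F'F sF) (Dc DF) // setSU.
Qed.

Lemma bd_to_link S y I : [disjoint I & S] ->
  bd (to_link S y) I = link_sgn S I * bd y (I :|: S).
Proof.
move=> dIS; rewrite /sbnd mulr_sumr.
rewrite [RHS]big_mkcond [LHS]big_mkcond; apply: eq_bigr => i _.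
rewrite !inE negb_or mulr1 /to_link; have [iI|iI] //= := boolP (i \in I).
have -> : [disjoint i |: I & S] = (i \notin S).
  by rewrite -!setI_eq0 setIUl setU_eq0 !setI_eq0 dIS andbT disjoints1.
case: ifP => [iS|]; last by rewrite mulr0.
rewrite /link_sgn big_setU1 //= sgnU // setUA mulr1.
by rewrite [RHS]mulrCA !mulrA; congr (_ * _).
Qed.

Lemma bd_to_link0 S y I : ~~ [disjoint I & S] -> bd (to_link S y) I = 0.
Proof.
move=> dIS; rewrite /sbnd big1 // => i iI; rewrite /to_link ifN ?mulr0 //.
by apply: contraNN dIS; apply: disjointWl; exact: subsetUr.
Qed.

Lemma to_linkK S p z : supp_on (link D S) p z -> to_link S (of_link S z) =1 z.
Proof.
move=> sz I; rewrite /to_link /of_link subsetUr; case: ifPn => dIS.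
  rewrite setDUl setDv setU0 (_ : I :\: S = I) ?mulrA ?link_sgn_sqr ?mul1r //.
  by apply/setDidPl.
apply/esym/eqP; apply: contraNT dIS => /sz[].
by rewrite inE -disjoints_subset => /andP[].
Qed.

Lemma of_link_supp S p z :
  supp_on (link D S) p z -> rel_supp S (p + #|S|%:Z) (of_link S z).
Proof.
move=> sz F; rewrite /of_link; case: ifPn; last by rewrite eqxx.
move=> SF; rewrite mulf_eq0 negb_or => /andP[_ /sz[]].
rewrite inE -disjoints_subset => /andP[_]; rewrite setDUK // => DF <-; split=> //.
by have := cardsID S F; rewrite (setIidPr SF); lia.
Qed.

Lemma to_link_supp S p y :
  rel_supp S (p + #|S|%:Z) y -> supp_on (link D S) p (to_link S y).
Proof.
move=> sy I; rewrite /to_link; case: ifPn; last by rewrite eqxx.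
move=> dIS; rewrite mulf_eq0 negb_or => /andP[_ /sy[DI _]].
rewrite inE -disjoints_subset dIS DI cardsU.
by move: dIS; rewrite -setI_eq0 => /eqP->; rewrite cards0; split=> //; lia.
Qed.

Lemma bd_of_link S p z J : supp_on (link D S) p z -> S \subset J ->
  bd (of_link S z) J = link_sgn S (J :\: S) * bd z (J :\: S).
Proof.
move=> sz SJ; have dJ : [disjoint J :\: S & S].
  by rewrite -setI_eq0 setIDAC -setIDA setDv setI0.
have <- : bd (to_link S (of_link S z)) (J :\: S) = bd z (J :\: S).
  by rewrite /sbnd; apply: eq_bigr => i _; rewrite (to_linkK sz).
by rewrite bd_to_link // mulrA link_sgn_sqr mul1r setDUK.
Qed.

Hypothesis Dg : gorenstein_star k D.
Let d := max_face_card D.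

(** The link of S has one-dimensional homology in cardinality d - #|S| and no larger faces, so there
    homologous cycles are equal. *)
Lemma rel_cycle_top S : S \in D -> exists y,
  [/\ rel_cycle S d y, exists F, y F != 0
    & forall y', rel_cycle S d y' -> exists a, forall F, y' F = a * y F].
Proof.
move=> DS; have := Dg S (d%:Z - 1 - #|S|%:Z).
rewrite /= DS andbT subrK eqxx /reduced_homology.
rewrite (_ : d%:Z - 1 - #|S|%:Z + 1 = d%:Z - #|S|%:Z); last by lia.
move: (d%:Z - _ : int) (subrK #|S|%:Z d) => p pE [f [g fK gK]].
have [z zE] := hclass_surj (g 1).
have Lc := @link_complex S.
have sz : supp_on (link D S) p (ext (val z)) by exact: ext_supp.
have no_top y : supp_on (link D S) (p + 1) y -> forall I, y I = 0.
  move=> sy I; apply/eqP/negPn/negP => /sy[]; rewrite inE -disjoints_subset.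
  move=> /andP[dIS DI] cI.
  have : (#|I :|: S| <= d)%N.
    exact: (leq_bigmax_cond (F := fun F : {set 'I_n} => #|F|)).
  rewrite cardsU; move: dIS; rewrite -setI_eq0 => /eqP->; rewrite cards0; lia.
exists (of_link S (ext (val z))); split.
- split; first by rewrite -pE; exact: of_link_supp.
  by move=> J SJ; rewrite (bd_of_link sz SJ) cycle_ext // mulr0.
- apply: contrapT => noF; have z0 I : ext (val z) I = 0.
    rewrite -(to_linkK sz) /to_link; case: ifP => // _.
    have [->|nz] := eqVneq (of_link S (ext (val z)) (I :|: S)) 0; first by rewrite mulr0.
    by case: noF; eexists; exact: nz.
  have : hclass z = hclass (0 : chain_cycle _ _ p).
    apply/hclass_eq => //; exists (fun=> 0); first by move=> I; rewrite eqxx.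
    move=> J; by rewrite z0 ext_cycle0 subr0 /sbnd big1 // => i _; rewrite mulr0.
  rewrite zE => /(congr1 f); rewrite gK hclass0 linear0.
  by apply/eqP; exact: oner_neq0.
move=> y' [sy' cy']; rewrite -pE in sy'.
have sty := to_link_supp sy'.
have [|z' z'E] := cycle_restr (w := fun=> 1) Lc sty.
  move=> J; have [dJ|dJ] := boolP [disjoint J & S]; last exact: bd_to_link0.
  by rewrite bd_to_link // cy' ?subsetUr // mulr0.
exists (f (hclass z')).
have : hclass z' = hclass (f (hclass z') *: z).
  apply: (can_inj fK); rewrite hclassZ linearZ zE gK.
  by rewrite [RHS]mulr1.
move=> /(hclass_eq Lc _ _)[y sy yE] F.
have [SF|SF] := boolP (S \subset F); last first.
  rewrite /of_link (negPf SF) mulr0; apply/eqP; apply: contraNT SF.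
  by move=> /sy'[].
have dF : [disjoint F :\: S & S].
  by rewrite -setI_eq0 setIDAC -setIDA setDv setI0.
have := yE (F :\: S); rewrite /sbnd big1 => [|i _]; last by rewrite (no_top _ sy) mulr0.
rewrite z'E /to_link dF setDUK // /of_link SF => /esym/eqP; rewrite subr_eq0.
have -> : ext (val (f (hclass z') *: z)) (F :\: S) =
    f (hclass z') * ext (val z) (F :\: S).
  by rewrite /ext mulr_sumr; apply: eq_bigr => I _; rewrite !ffunE.
move=> /eqP E; rewrite mulrCA -E mulrA link_sgn_sqr mul1r //.
Qed.

(** Below the top the link of S has no homology; p also counts the elements of S, hence the degree p
    - #|S| - 1. *)
Lemma rel_exact S p y : S \in D -> p != d -> rel_cycle S p y ->
  exists2 y', rel_supp S (p + 1) y' & forall J, S \subset J -> bd y' J = y J.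
Proof.
move=> DS pd [sy cy]; have := Dg S (p - #|S|%:Z - 1).
rewrite /= ifN; last first.
  by rewrite DS andbT; apply: contra pd => /eqP E; apply/eqP; rewrite /d; lia.
rewrite /reduced_homology subrK => H0.
have Lc := @link_complex S.
have pE := subrK #|S|%:Z p; rewrite -pE in sy.
have sty := to_link_supp sy.
have [|z zE] := cycle_restr (w := fun=> 1) Lc sty.
  move=> J; have [dJ|dJ] := boolP [disjoint J & S]; last exact: bd_to_link0.
  by rewrite bd_to_link // cy ?subsetUr // mulr0.
have : hclass z = hclass (0 : chain_cycle _ _ (p - #|S|%:Z)).
  by rewrite hclass0 (H0 (hclass z)).
move=> /(hclass_eq Lc _ _)[u su uE].
exists (of_link S u).
  by rewrite (_ : p + 1 = p - #|S|%:Z + 1 + #|S|%:Z); [exact: of_link_supp | lia].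
move=> J SJ; rewrite (bd_of_link su SJ) uE zE.
have dF : [disjoint J :\: S & S].
  by rewrite -setI_eq0 setIDAC -setIDA setDv setI0.
by rewrite ext_cycle0 subr0 /to_link dF setDUK // mulrA link_sgn_sqr mul1r.
Qed.

End RelativeCycles.

(** * Purity, and nonvanishing of the orientation cycle on facets *)

Section Orientation.
Variables (k : fieldType) (n : nat) (D : {set {set 'I_n}}).
Hypothesis Dc : simplicial_complex D.
Hypothesis Dg : gorenstein_star k D.
Implicit Types (i : 'I_n) (S I J F G H E : {set 'I_n}) (y z : {set 'I_n} -> k).
Notation bd := (sbnd (fun=> 1)).
Let d := max_face_card D.

(** Purity: any face in the support of a nonzero top cycle relative to S will do. *)
Lemma face_in_facet S : S \in D -> exists F, [/\ F \in D, S \subset F & #|F| = d].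
Proof.
case/(rel_cycle_top Dc Dg) => y [[sy _] [F /sy[DF SF [cF]]] _].
by exists F.
Qed.

Lemma rel_cycle_restrict S S' p y : S \subset S' -> rel_cycle D S p y ->
  rel_cycle D S' p (fun F => if S' \subset F then y F else 0).
Proof.
move=> SS' [sy cy]; split=> [F|J S'J].
  by case: ifP => [S'F /sy[]|]; rewrite ?eqxx.
rewrite -(cy J) ?(subset_trans SS') // /sbnd; apply: eq_bigr => i _.
by rewrite (subset_trans S'J) ?subsetUr.
Qed.

(** The difference of two vertices of the link of S, with signs that give each of them boundary 1 at
    S. *)
Let two_point S i j F : k :=
  sgn k i S * (F == i |: S)%:R - sgn k j S * (F == j |: S)%:R.

Let eq_setU1 S a b : a \notin S -> b \notin S -> (a |: S == b |: S) = (a == b).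
Proof.
move=> aS bS; apply/eqP/eqP => [E|->//].
by have := setU11 a S; rewrite E !inE (negPf aS) orbF => /eqP.
Qed.

Let two_point_cycle S i j : i \notin S -> j \notin S ->
  i |: S \in D -> j |: S \in D ->
  rel_cycle D S (#|S|.+1) (two_point S i j).
Proof.
move=> iS jS Di Dj; split=> [F|J SJ].
  rewrite /two_point; have [->|] := eqVneq F (i |: S).
    by rewrite Di subsetUr cardsU1 iS.
  rewrite mulr0 sub0r oppr_eq0; have [->|] := eqVneq F (j |: S).
    by rewrite Dj subsetUr cardsU1 jS.
  by rewrite mulr0 eqxx.
have [->|JS] := eqVneq J S; last first.
  rewrite /sbnd big1 // => a aJ.
  have JSa v : v \notin S -> (a |: J == v |: S) = false.
    move=> vS; apply/eqP=> /(congr1 (fun X : {set _} => #|X|)).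
    rewrite !cardsU1 aJ vS !add1n => -[cJ]; move/eqP: JS; apply; apply/esym/eqP.
    by rewrite eqEcard SJ cJ leqnn.
  by rewrite /two_point !JSa // !mulr0 subrr mulr0.
rewrite /sbnd /two_point.
under eq_bigr do rewrite mulr1 mulrBr.
rewrite sumrB (bigD1 i) //= [X in _ - X](bigD1 j) //= !eqxx !mulr1 !sgn_sqr.
rewrite !big1 ?addr0 ?subrr // => a /andP[aS /negPf av].
  by rewrite eq_setU1 // av !mulr0.
by rewrite eq_setU1 // av !mulr0.
Qed.

(* Induction on d - |S|.  Suppose that y is zero at F and nonzero at F', and
   take j in F \ S and i in F' \ S.  If |S| < d - 1, the two-point cycle on i
   and j bounds a chain y2 of the link.  By induction a vertex of the link lies
   only on facets where y is nonzero (V1) or only on facets where it is zero,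
   so the part y2' of y2 on V1 is bounded by the single point i, which
   contradicts bd (bd y2') = 0. *)
Lemma rel_cycle_nonvanishing S y : S \in D -> rel_cycle D S d y ->
  (exists F, y F != 0) ->
  forall F, F \in D -> S \subset F -> #|F| = d -> y F != 0.
Proof.
have [m] : exists m, (d <= #|S| + m)%N by exists d; exact: leq_addl.
(* For m = 0 the only set of cardinality d above S is S itself. *)
elim: m S y => [|m IH] S y.
  rewrite addn0 => dS DS [sy _] [F' nz] F DF SF cF.
  have [_ SF' [cF']] := sy _ nz.
  have E G : S \subset G -> #|G| = d -> G = S.
    by move=> SG cG; apply/eqP; rewrite eq_sym eqEcard SG cG.
  by rewrite (E F) // -(E F').
move=> dS DS cy [F' nz] F DF SF cF; apply/eqP => y0.
have [sy _] := cy; have [DF' SF' [cF']] := sy _ nz.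
have sub_facet G : S \subset G -> #|G| = d -> (exists2 i, i \in G & i \notin S) \/ G = S.
  move=> SG cG; have [GS|/subsetPn[i]] := boolP (G \subset S); [right|left; by exists i].
  by apply/eqP; rewrite eqEsubset GS.
have [[j jF jS]|FS] := sub_facet F SF cF; last first.
  move: nz; rewrite (_ : F' = F) ?y0 ?eqxx // FS.
  by apply/eqP; rewrite eq_sym eqEcard SF' cF' -cF FS leqnn.
have [[i iF' iS]|FS] := sub_facet F' SF' cF'; last first.
  have := subset_leq_card SF; have : F != S by apply: contraNneq jS => <-.
  rewrite eq_sym => FS'; have : S \proper F by rewrite properEneq FS'.
  by move=> /proper_card; rewrite cF -cF' FS ltnn.
have Di : i |: S \in D by apply: (Dc DF'); rewrite subUset sub1set iF'.
have Dj : j |: S \in D by apply: (Dc DF); rewrite subUset sub1set jF.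
have cu := two_point_cycle iS jS Di Dj.
(* If the link of S is zero-dimensional, y and the two-point cycle are multiples of one generator;
   so y, being nonzero somewhere, cannot vanish at F, where the two-point cycle does not. *)
have [Sd|Sd] := eqVneq #|S|.+1 d.
  rewrite Sd in cu; have [y1 [_ _ y1P]] := rel_cycle_top Dc Dg DS.
  have [a aE] := y1P _ cy; have [b bE] := y1P _ cu.
  have FE : F = j |: S.
    by apply/esym/eqP; rewrite eqEcard subUset sub1set jF SF cF cardsU1 jS -Sd leqnn.
  have ij : i != j.
    apply: contraNneq nz => ij; suff -> : F' = F by rewrite y0.
    by apply/esym/eqP; rewrite eqEcard cF cF' leqnn FE -ij subUset sub1set iF' SF'.
  move: (bE F); rewrite /two_point FE eqxx eq_sym eq_setU1 // (negPf ij).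
  move: y0; rewrite aE => /eqP; rewrite mulf_eq0 FE => /orP[/eqP a0|/eqP->].
    by move: nz; rewrite aE a0 mul0r eqxx.
  rewrite !mulr0 sub0r mulr1 => /eqP; rewrite oppr_eq0 => /eqP s0.
  by have := sgn_sqr k j S; rewrite s0 mulr0 => /esym/eqP; rewrite oner_eq0.
have [//|y2 sy2 y2E] := rel_exact Dc Dg DS _ cu.
pose V1 v := `[< exists G, v |: S \subset G /\ y G != 0 >].
have V1P v G : v \notin S -> V1 v -> G \in D -> v |: S \subset G -> #|G| = d -> y G != 0.
  move=> vS /asboolP[H [vH nzH]] DG vG cG.
  have cy' := rel_cycle_restrict (subsetUr [set v] S) cy.
  have := IH (v |: S) _ _ _ cy'; rewrite cardsU1 vS add1n addSnnS => /(_ dS).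
  move=> /(_ (Dc DG vG)) /(_ _ G DG vG cG); rewrite vG; apply.
  by exists H; rewrite vH.
have V1e a b : a \notin S -> b \notin S -> V1 a -> y2 (b |: (a |: S)) != 0 -> V1 b.
  (* A face in the support of [y2] extends to a facet containing a and b, so [V1] passes from a to
     b. *)
  move=> aS bS Va /sy2[/face_in_facet[G [DG abG cG]] _ _].
  apply/asboolP; exists G; split.
    by apply: subset_trans abG; rewrite setUCA subsetUr.
  by apply: (V1P a) => //; apply: subset_trans abG; rewrite subsetUr.
pose y2' E := if [forall v in E :\: S, V1 v] then y2 E else 0.
have bdE a : a \notin S -> bd y2' (a |: S) = if V1 a then bd y2 (a |: S) else 0.
  move=> aS; rewrite /sbnd; case: ifPn => Va; last first.
    rewrite big1 // => b _; rewrite /y2' ifN ?mulr0 //.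
    rewrite negb_forall_in; apply/exists_inP; exists a => //.
    by rewrite !inE aS eqxx orbT.
  apply: eq_bigr => b; rewrite !inE negb_or => /andP[ba bS]; congr (_ * _).
  rewrite /y2'; case: ifPn => // nV; apply/esym/eqP; apply: contraNT nV => nz2.
  apply/forall_inP => v; rewrite !inE => /andP[vS /or3P[/eqP->|/eqP->|]] //.
    by apply: (V1e a).
  by rewrite (negPf vS).
have Vi : V1 i by apply/asboolP; exists F'; rewrite subUset sub1set iF' SF'.
have nVj : ~~ V1 j.
  apply/negP=> Vj; have := V1P j F jS Vj DF; rewrite y0 eqxx => H.
  by suff: false by []; apply: H => //; rewrite subUset sub1set jF.
have := sbnd_sbnd (fun=> 1) y2' S; rewrite {1}/sbnd (bigD1 i) //= bdE // Vi.
rewrite y2E ?subsetUr // /two_point eqxx eq_setU1 //.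
have -> : (i == j) = false by apply: contraNF nVj => /eqP<-.
rewrite mulr0 subr0 !mulr1 sgn_sqr big1 ?addr0 => [/eqP|a /andP[aS ai]].
  by rewrite oner_eq0.
rewrite bdE //; case: ifPn => [Va|_]; last by rewrite mulr0.
rewrite y2E ?subsetUr // /two_point !eq_setU1 // (negPf ai).
have -> : (a == j) = false by apply: contraNF nVj => /eqP<-.
by rewrite !mulr0 subrr mulr0.
Qed.

End Orientation.

(** * Alexander duality *)

Lemma sum_enum_val (V : nmodType) (T : finType) (F : T -> V) :
  \sum_i F i = \sum_(i < #|T|) F (enum_val i).
Proof. exact: (reindex _ (onW_bij _ (@enum_val_bij T))). Qed.

(** A vector orthogonal to the kernel of a matrix lies in its row space; the columns of [cokermx M]
    serve as the test vectors e. *)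
Lemma orth_kernel (k : fieldType) (T1 T2 : finType) (a : T1 -> T2 -> k) (y : T1 -> k) :
  (forall e : T1 -> k, (forall j, \sum_i a i j * e i = 0) -> \sum_i y i * e i = 0) ->
  exists h, forall i, y i = \sum_j a i j * h j.
Proof.
move=> yP; pose M := \matrix_(j < #|T2|, i < #|T1|) a (enum_val i) (enum_val j).
pose Y := \row_(i < #|T1|) y (enum_val i).
have /submxP[H YE] : (Y <= M)%MS.
  rewrite submxE; apply/eqP/rowP=> c; rewrite !mxE.
  transitivity (\sum_i y i * cokermx M (enum_rank i) c).
    rewrite [RHS]sum_enum_val.
    by apply: eq_bigr => i _; rewrite mxE enum_valK.
  apply: yP => j; have := mulmx_coker M => /matrixP/(_ (enum_rank j) c).
  rewrite !mxE => E; rewrite -[RHS]E [LHS]sum_enum_val.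
  by apply: eq_bigr => i _; rewrite !mxE enum_valK enum_rankK.
exists (fun j => H 0 (enum_rank j)) => i; move/rowP: YE => /(_ (enum_rank i)).
rewrite !mxE enum_rankK => ->; rewrite [RHS]sum_enum_val.
by apply: eq_bigr => j _; rewrite !mxE enum_valK enum_rankK mulrC.
Qed.

Section ComplementDuality.
Variables (n : nat) (A : comNzRingType).
Implicit Types (I J K F : {set 'I_n}) (y h : {set 'I_n} -> A).
Notation bd := (sbnd (fun=> 1)).

Definition compl_sgn K : A := \prod_(i in K) (-1) ^+ i.

(** The signs of i in a set and in its complement multiply to (-1)^i, so with this sign
    complementation exchanges boundary and coboundary. *)
Definition dualize h K : A := compl_sgn K * h (~: K).

Lemma compl_sgn_sqr K : compl_sgn K * compl_sgn K = 1.
Proof. by rewrite -big_split big1 // => i _; rewrite /= -expr2 sqrr_sign. Qed.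

Lemma setCU1 i K : ~: (i |: K) = ~: K :\ i.
Proof. by apply/setP=> j; rewrite !inE negb_or. Qed.

Lemma setCD1 i K : ~: (K :\ i) = i |: ~: K.
Proof. by apply/setP=> j; rewrite !inE negb_and negbK. Qed.

Lemma bd_dualize h : bd (dualize h) =1 dualize (cobnd h).
Proof.
move=> K; rewrite /sbnd /dualize /cobnd mulr_sumr.
apply: eq_big => [i|i iK]; first by rewrite inE.
rewrite setCU1 /compl_sgn big_setU1 //= -(sgn_compl A i K) mulr1 !mulrA sgn_sqr mul1r.
by congr (_ * _); rewrite mulrC.
Qed.

Lemma cobnd_dualize h : cobnd (dualize h) =1 dualize (bd h).
Proof.
move=> K; rewrite /sbnd /dualize /cobnd mulr_sumr.
apply: eq_big => [i|i iK]; first by rewrite inE negbK.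
rewrite setCD1 (_ : compl_sgn K = (-1) ^+ i * compl_sgn (K :\ i)); last first.
  by rewrite -{1}(setD1K iK) /compl_sgn big_setU1 ?inE ?eqxx.
rewrite -(sgn_compl A i K) mulr1 !mulrA; congr (_ * _).
by rewrite [RHS]mulrAC -[sgn A i K * _ * _]mulrA sgn_sqr mulr1.
Qed.

End ComplementDuality.

Section AlexanderDual.
Variables (k : fieldType) (n : nat) (D : {set {set 'I_n}}).
Hypothesis Dc : simplicial_complex D.
Implicit Types (i : 'I_n) (S I J F G H B K : {set 'I_n}) (y z : {set 'I_n} -> k).
Notation bd := (sbnd (fun=> 1)).
Notation G := (alexander_dual D).

Lemma alexander_dual_complex : simplicial_complex G.
Proof.
move=> F F'; rewrite !inE => nF F'F; apply: contra nF => DF'.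
by apply: Dc DF' _; rewrite setCS.
Qed.

(* The reduced homology of the restrictions of X in cardinality p looks like
   that of the ideal: it vanishes on B in X, and pairing with zeta identifies
   it with k on B outside X. *)
Definition detecting_cocycle (X : {set {set 'I_n}}) (p : int)
    (zeta : {set 'I_n} -> k) : Prop :=
  [/\ forall I, I \in X -> cobnd zeta I = 0,
      forall B z, supp_on (X ::&: B) p z -> (forall J, bd z J = 0) ->
        (B \notin X -> \sum_I zeta I * z I = 0) ->
        exists2 y, supp_on (X ::&: B) (p + 1) y & bd y =1 z
    & forall B, B \notin X -> exists z,
        [/\ supp_on (X ::&: B) p z, forall J, bd z J = 0
          & \sum_I zeta I * z I = 1]].

Lemma powerset_complex B : simplicial_complex (powerset B).
Proof. by move=> F F'; rewrite !inE => FB F'F; exact: subset_trans FB. Qed.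

Lemma cone_exact B i p z : i \in B -> supp_on (powerset B) p z ->
  (forall J, bd z J = 0) ->
  supp_on (powerset B) (p + 1) (cone i z) /\ bd (cone i z) =1 z.
Proof.
move=> iB sz cz; split=> [I|J]; last first.
  by rewrite -[RHS](cone_bnd i) /cone cz mulr0 if_same addr0.
rewrite /cone; case: ifPn; last by rewrite eqxx.
move=> iI; rewrite mulf_eq0 negb_or => /andP[_ /sz[]]; rewrite !inE => IB <-.
split; last by rewrite (cardsD1 i I) iI addnC PoszD.
by rewrite -(setD1K iI) subUset sub1set iB IB.
Qed.

Hypothesis Dg : gorenstein_star k D.
Let d := max_face_card D.

(** The dual [eta] of the orientation cycle [eps] is a cocycle carried by sets of cardinality p + 1
    outside G, and [zeta] is a primitive of it. A chain filling z in the simplex on B pairs with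
    [eta] as z pairs with [zeta]. *)
Lemma gorenstein_detecting_cocycle :
  set0 \in D -> (exists i, ~: [set i] \notin D) ->
  exists zeta, detecting_cocycle G (n%:Z - d%:Z - 1) zeta.
Proof.
move=> D0 [i0 Di0]; pose p : int := n%:Z - d%:Z - 1; rewrite -/p.
have cC F : #|~: F|%:Z = n%:Z - #|F|%:Z.
  by have := cardsC F; rewrite card_ord; lia.
have [eps [ceps nzeps _]] := rel_cycle_top Dc Dg D0.
have [seps ceps0] := ceps.
have eps_nz F : F \in D -> #|F| = d -> eps F != 0.
  by move=> DF cF; apply: (rel_cycle_nonvanishing Dc Dg D0 ceps) => //; exact: sub0set.
pose eta := dualize eps.
have eta0 I : cobnd eta I = 0.
  by rewrite cobnd_dualize /dualize ceps0 ?sub0set // mulr0.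
have [zeta zetaE] := cobnd_exact i0 eta0.
have eta_nz K : eta K != 0 -> ~: K \in D.
  by rewrite /eta /dualize mulf_eq0 negb_or => /andP[_ /seps[]].
have face_card F : F \in D -> (#|F| <= d)%N.
  by move=> DF; exact: (leq_bigmax_cond (F := fun F : {set 'I_n} => #|F|)).
(* For p = 0 the augmentation would contribute homology on B = set0; but then
   D would contain the complement of every point. *)
have p_neq0 : p != 0.
  apply/eqP=> p0; have [F [DF _ cF]] := face_in_facet Dc Dg D0.
  (* On singletons [eta] is the constant [zeta set0], so being nonzero at the complement of one
     facet it is nonzero at all of them. *)
  have zeta1 i : eta [set i] = zeta set0.
    rewrite -zetaE /cobnd big_set1 setDv (_ : sgn _ _ _ = 1) ?mul1r //.
    by rewrite sgn1 ltnn.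
  have : #|~: F|%:Z = 1 by rewrite cC cF; move: p0; rewrite /p; lia.
  case=> /eqP/cards1P[j Fj].
  have : eta [set j] != 0.
    rewrite -Fj /eta /dualize setCK mulf_neq0 ?eps_nz //.
    by apply: contra_eq_neq (compl_sgn_sqr k (~: F)) => ->;
      rewrite mulr0 eq_sym oner_neq0.
  rewrite zeta1 -(zeta1 i0) => /eta_nz; rewrite (negPf Di0) //.
have B_ne B : B \notin G -> exists i, i \in B.
  rewrite inE negbK => DB; apply/set0Pn; apply: contraNneq Di0 => B0.
  by apply: Dc DB _; rewrite B0 setC0 subsetT.
have tau_nz K : compl_sgn k K != 0.
  by apply: contra_eq_neq (compl_sgn_sqr k K) => ->; rewrite mulr0 eq_sym oner_neq0.
exists zeta; split.
- move=> I; rewrite inE zetaE => nI; apply/eqP; apply: contraNT nI => /eta_nz.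
  by [].
- move=> B z sz cz zz.
  have sz' : supp_on (powerset B) p z by move=> I /sz[]; rewrite !inE => /andP[].
  (* For B in G the whole simplex on B lies in G and a cone fills z; B = set0 has no apex, but then
     z is zero because p is not. *)
  have [BG|BG] := boolP (B \in G).
    have [B0|/set0Pn[v vB]] := eqVneq B set0.
      exists (fun=> 0) => [I|J]; first by rewrite eqxx.
      rewrite /sbnd big1 => [|i _]; last by rewrite mulr0.
      apply/esym/eqP; apply: contraNT p_neq0 => /sz'[]; rewrite B0 inE subset0.
      by move=> /eqP->; rewrite cards0 => <-.
    have [sy yE] := cone_exact vB sz' cz; exists (cone v z) => //.
    move=> I /sy[]; rewrite !inE => IB ->; split=> //; rewrite IB andbT.
    by have := alexander_dual_complex BG IB; rewrite inE.
  (* For B outside G the cone fills z only in the simplex on B; a boundary will correct it. *)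
  have [v vB] := B_ne _ BG.
  have [sy0 y0E] := cone_exact vB sz' cz; set y0 := cone v z in sy0 y0E.
  have eta_y0 : \sum_I eta I * y0 I = 0.
    rewrite -[RHS](zz BG); under [RHS]eq_bigr do rewrite -y0E.
    by rewrite cobnd_adj; apply: eq_bigr => I _; rewrite zetaE.
  set S := ~: B; have DS : S \in D by move: BG; rewrite inE negbK.
  pose P F := [&& F \in D, S \subset F & #|F| == d].
  pose yy F := if P F then compl_sgn k (~: F) * y0 (~: F) else 0.
  pose a F J : k := if P F && (S \subset J) then bd (fun K => (K == F)%:R) J else 0.
  have epsS := rel_cycle_restrict (sub0set S) ceps.
  (* eta_y0 says that y0, transported to the facets of D above S, is orthogonal
     to eps, hence to all relative top cycles at S; so it is a coboundary h, and
     the dual chain y' of h moves y0 into G. *)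
  have [h hE] : exists h : {set 'I_n} -> k, forall F, yy F = \sum_J a F J * h J.
    apply: orth_kernel => e aE.
    pose e' F := if P F then e F else 0.
    have ce' : rel_cycle D S d e'.
      split=> [F|J SJ]; rewrite /e'.
        by rewrite /P; case: ifP; [case/and3P=> -> -> /eqP->|rewrite eqxx].
      rewrite sbnd_expand -[RHS](aE J); apply: eq_bigr => F _.
      by rewrite /a SJ andbT; case: ifP; rewrite ?mul0r // mulrC.
    have [y1 [_ _ y1P]] := rel_cycle_top Dc Dg DS.
    have [b bE] := y1P _ ce'; have [c cE] := y1P _ epsS.
    (* As [eps] is nonzero on every facet, its restriction to the faces above S is nonzero and spans
       the relative top cycles. *)
    have c0 : c != 0.
      have [F [DF SF cF]] := face_in_facet Dc Dg DS.
      have := eps_nz _ DF cF; have := cE F; rewrite SF => ->.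
      by rewrite mulf_eq0 negb_or => /andP[].
    transitivity (b / c * \sum_F yy F * (if S \subset F then eps F else 0)).
      rewrite mulr_sumr; apply: eq_bigr => F _.
      rewrite cE mulrCA !mulrA divfK // -mulrA -bE.
      by rewrite /yy /e'; case: ifP; rewrite ?mul0r.
    rewrite [X in _ * X](_ : _ = 0) ?mulr0 // -[RHS]eta_y0.
    rewrite [RHS](reindex_inj (@setC_inj _)); apply: eq_bigr => F _.
    rewrite /eta /dualize setCK /yy; case: ifPn => [/and3P[_ -> _]|nP].
      by rewrite mulrAC.
    rewrite mul0r; apply/esym/eqP; rewrite mulf_eq0; apply: contraNT nP.
    rewrite negb_or mulf_eq0 negb_or => /andP[/andP[_ /seps[DF _ [cF]]] /sy0[]].
    by rewrite inE => sF _; rewrite /P DF cF eqxx andbT /S -(setCK F) setCS.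
  pose h' J := if (S \subset J) && (#|J|.+1 == d) then h J else 0.
  pose hS J : k := if S \subset J then h J else 0.
  have h'E F : P F -> cobnd h' F = yy F.
    move=> PF; have [DF SF /eqP cF] := and3P PF.
    rewrite hE; transitivity (\sum_J hS J * bd (fun K => (K == F)%:R) J).
      rewrite cobnd_adj (bigD1 F) //= eqxx mulr1.
      rewrite [X in _ + X]big1 => [|K /negPf->]; last by rewrite mulr0.
      rewrite addr0; apply: eq_bigr => i iF; rewrite /h' /hS; congr (_ * _).
      by rewrite -cF (cardsD1 i F) iF add1n eqxx andbT.
    apply: eq_bigr => J _; rewrite /a /hS PF /=.
    by case: ifP; rewrite ?mul0r // mulrC.
  pose y' := dualize h'.
  have sy' : supp_on (powerset B) (p + 1 + 1) y'.
    move=> K; rewrite /y' /dualize mulf_eq0 negb_or => /andP[_].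
    rewrite /h'; case: ifP; last by rewrite eqxx.
    move=> /andP[SK /eqP cK] _; rewrite inE -(setCK B) -(setCK K) setCS; split=> //.
    by rewrite setCK; have := cC K; rewrite /p -cK; lia.
  have sby' : supp_on (powerset B) (p + 1) (bd y').
    by have := sbnd_supp (w := fun=> 1) (@powerset_complex B) sy'; rewrite addrK.
  (* On a set K outside G the two terms agree: the complement of K is a facet above S, where the
     coboundary of [h'] is [yy]. *)
  exists (fun K => y0 K - bd y' K); last first.
    by move=> J; rewrite sbndB sbnd_sbnd subr0.
  move=> K nz; have [KB cK] : K \in powerset B /\ #|K|%:Z = p + 1.
    have [y00|/sy0//] := eqVneq (y0 K) 0; apply: sby'.
    by move: nz; rewrite y00 sub0r oppr_eq0.
  split=> //; move: KB; rewrite !inE => KB; rewrite KB andbT.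
  apply: contraNN nz => DK; rewrite subr_eq0 bd_dualize /dualize h'E; last first.
    rewrite /P DK setCS KB /=; apply/eqP; have := cC K; move: cK; rewrite /p.
    by move: #|K| #|~: K| => u w; lia.
  rewrite /yy setCK ifT; last first.
    rewrite /P DK setCS KB /=; apply/eqP; have := cC K; move: cK; rewrite /p.
    by move: #|K| #|~: K| => u w; lia.
  by rewrite mulrA compl_sgn_sqr mul1r.
- move=> B BG; have DS : ~: B \in D by move: BG; rewrite inE negbK.
  have [F [DF SF cF]] := face_in_facet Dc Dg DS.
  (* Supported on the complement of a facet and scaled to pair with [eta] to 1. Its boundary lies in
     G, since a set of cardinality p = n - d - 1 has a complement too large for D. *)
  pose u K : k := (eta (~: F))^-1 * (K == ~: F)%:R.
  have nz : eta (~: F) != 0 by rewrite /eta /dualize setCK mulf_neq0 ?eps_nz.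
  have su : supp_on (powerset B) (p + 1) u.
    move=> K; rewrite /u; have [->|] := eqVneq K (~: F); last by rewrite mulr0 eqxx.
    by move=> _; rewrite inE -(setCK B) setCS SF cC cF /p; split=> //; lia.
  have sbu : supp_on (powerset B) p (bd u).
    by have := sbnd_supp (w := fun=> 1) (@powerset_complex B) su; rewrite addrK.
  exists (bd u); split; last 1 first.
  + rewrite cobnd_adj (bigD1 (~: F)) //= /u eqxx mulr1 zetaE divff // big1 ?addr0 //.
    by move=> K /negPf->; rewrite !mulr0.
  + move=> K /sbu[]; rewrite !inE => -> cK; split=> //; rewrite andbT.
    by apply/negP=> /face_card; have := cC K; move: cK; rewrite /p; lia.
  + exact: sbnd_sbnd.
Qed.

End AlexanderDual.

(** * The isomorphism *)

Section Multigrading.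
Variables (k : fieldType) (n : nat).
Local Notation R := {mpoly k[n]}.
Implicit Types (i : 'I_n) (I J F B : {set 'I_n}) (b m : 'X_{1..n}).
Implicit Types (z y : {set 'I_n} -> R).
Notation bd := (sbnd (fun=> 1)).
Notation bdX := (sbnd (fun i => 'X_i : R)).

Definition mset I : 'X_{1..n} := [multinom (i \in I : nat) | i < n].
Definition mvars b : {set 'I_n} := [set i | b i != 0%N].

Lemma prod_mset I : \prod_(i in I) 'X_i = 'X_[mset I] :> R.
Proof.
rewrite mpolyXE_id [LHS]big_mkcond; apply: eq_bigr => i _.
by rewrite mnmE; case: (i \in I).
Qed.

Lemma mset_le I b : (mset I <= b)%MM = (I \subset mvars b).
Proof.
apply/mnm_lepP/subsetP => [le i iI|sub i].
  by rewrite inE -lt0n; have := le i; rewrite mnmE iI.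
by rewrite mnmE; case: (boolP (i \in I)) => // /sub; rewrite inE lt0n.
Qed.

Lemma mset_deg I : mdeg (mset I) = #|I|.
Proof.
rewrite mdegE -sum1_card [RHS]big_mkcond; apply: eq_bigr => i _.
by rewrite mnmE; case: (i \in I).
Qed.

Lemma mset_setU1 i I : i \notin I -> mset (i |: I) = (U_(i) + mset I)%MM.
Proof.
move=> iI; apply/mnmP => j; rewrite mnmDE mnm1E !mnmE !inE eq_sym.
by case: (eqVneq i j) => [<-|_]; rewrite ?(negPf iI).
Qed.

Lemma mcoeff_mulX (q : R) m b :
  (q * 'X_[m])@_b = if (m <= b)%MM then q@_(b - m)%MM else 0.
Proof.
case: ifPn => [le|nle]; first by rewrite -{1}(submK le) addmC mcoeffMX.
apply/eqP; apply: contraNT nle; rewrite -mcoeff_msupp (perm_mem (msuppMX _ _)).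
by case/mapP=> m' _ ->; apply/mnm_lepP=> i; rewrite mnmDE leq_addr.
Qed.

(* The coefficient of x^(b - I) in z I. *)
Definition mcomp b z I : k := (z I * 'X_[mset I])@_b.

Lemma mcomp_nz b z I : mcomp b z I != 0 -> I \subset mvars b /\ z I != 0.
Proof.
rewrite /mcomp => nz; split; last by apply: contraNneq nz => ->; rewrite mul0r mcoeff0.
by move: nz; rewrite mcoeff_mulX mset_le; case: ifP; rewrite ?eqxx.
Qed.

Lemma mcomp_supp (G : {set {set 'I_n}}) p z b :
  supp_on G p z -> supp_on (G ::&: mvars b) p (mcomp b z).
Proof. by move=> sz I /mcomp_nz[Ib /sz[GI ->]]; rewrite !inE GI Ib. Qed.

(** The weight x_i accounts for the passage from x^J to x^(i |: J), so within a fixed multidegree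
    all weights become 1. *)
Lemma mcomp_bd b z J : mcomp b (bdX z) J = bd (mcomp b z) J.
Proof.
rewrite /mcomp /sbnd mulr_suml raddf_sum; apply: eq_bigr => i iJ /=.
rewrite (_ : sgn R i J = (sgn k i J)%:MP); last by rewrite /sgn rmorphXn rmorphN rmorph1.
rewrite -!mulrA mcoeffCM mul1r; congr (_ * _@_b).
by rewrite mset_setU1 // mpolyXD mulrCA mulrA.
Qed.

Lemma mcomp_inj (u v : {set 'I_n} -> R) I :
  (forall b, mcomp b u I = mcomp b v I) -> u I = v I.
Proof.
by move=> E; apply/mpolyP=> b; have := E (mset I + b)%MM; rewrite /mcomp !mcoeffMX.
Qed.

(** Rebuilds a chain from its components in the multidegrees of s; the truncated difference is exact
    when I lies in the support of b. *)
Definition assemble (s : seq 'X_{1..n}) (Y : 'X_{1..n} -> {set 'I_n} -> k) I : R :=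
  \sum_(b <- s) Y b I *: 'X_[b - mset I].

Lemma mcomp_assemble s Y c I : uniq s ->
  (forall b, Y b I != 0 -> I \subset mvars b) ->
  mcomp c (assemble s Y) I = if c \in s then Y c I else 0.
Proof.
move=> us sY; rewrite /mcomp /assemble mulr_suml raddf_sum /=.
have E b : ((Y b I *: 'X_[b - mset I]) * 'X_[mset I])@_c = Y b I * (b == c)%:R.
  rewrite -scalerAl mcoeffZ; have [->|/sY] := eqVneq (Y b I) 0; first by rewrite !mul0r.
  by rewrite -mset_le => le; rewrite -mpolyXD submK // mcoeffX.
under eq_bigr do rewrite E; case: ifPn => cs.
  rewrite (bigD1_seq c) //= eqxx mulr1 big1 ?addr0 // => b /negPf->; exact: mulr0.
rewrite big_seq big1 // => b bs; have [bc|] := eqVneq b c; last by rewrite mulr0.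
by rewrite -bc bs in cs.
Qed.

Lemma assemble_supp (G : {set {set 'I_n}}) p s Y :
  (forall b, supp_on G p (Y b)) -> supp_on G p (assemble s Y).
Proof.
move=> sY I nz; suff [b /sY] : exists b, Y b I != 0 by [].
apply: contrapT => no; move/eqP: nz; apply; rewrite /assemble big1 // => b _.
have [->|nzb] := eqVneq (Y b I) 0; first by rewrite scale0r.
by case: no; exists b.
Qed.

Lemma SR_idealP (G : {set {set 'I_n}}) (g : R) : simplicial_complex G ->
  SR_ideal G g <-> forall b, g@_b != 0 -> mvars b \notin G.
Proof.
move=> Gs; split=> [[h ->] b|gG].
  rewrite raddf_sum /= => nz.
  have [F FG] : exists2 F, F \notin G & (h F * \prod_(i in F) 'X_i)@_b != 0.
    apply/exists_inP; apply: contraNT nz; rewrite negb_exists_in => /forall_inP h0.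
    by rewrite big1 // => F /h0; rewrite negbK => /eqP.
  rewrite prod_mset mcoeff_mulX mset_le; case: ifP; last by rewrite eqxx.
  by move=> Fb _; apply: contra FG => Gb; exact: Gs Gb Fb.
(* Each monomial of g is attached to the generator of its own support. *)
exists (fun F => \sum_(b <- msupp g | mvars b == F) g@_b *: 'X_[b - mset F]).
under eq_bigr do rewrite prod_mset mulr_suml.
rewrite (exchange_big_dep xpredT) //= [LHS]mpolyE [LHS]big_seq [RHS]big_seq.
apply: eq_bigr => b; rewrite mcoeff_msupp => /gG bG.
rewrite (big_pred1 (mvars b)) => [|F]; last first.
  by apply/andP/eqP => [[_ /eqP->]|->].
by rewrite -scalerAl -mpolyXD submK // mset_le.
Qed.

End Multigrading.

(** * The graded isomorphism given by a detecting cocycle *)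

Section Isomorphism.
Variables (k : fieldType) (n : nat) (G : {set {set 'I_n}}).
Local Notation R := {mpoly k[n]}.
Notation bd := (sbnd (fun=> 1)).
Notation bdX := (sbnd (fun i => 'X_i : R)).
Hypothesis Gs : simplicial_complex G.
Variables (p : int) (zeta : {set 'I_n} -> k).
Hypothesis zetaP : detecting_cocycle G p zeta.
Notation cycles := (chain_cycle (fun i : 'I_n => 'X_i : R) G p).

Definition cocycle_map (z : cycles) : R^o :=
  \sum_I (zeta I)%:MP * (ext (val z) I * 'X_[mset I]).

Lemma mcoeff_cocycle_map z b :
  (cocycle_map z : R)@_b = \sum_I zeta I * mcomp b (ext (val z)) I.
Proof. by rewrite raddf_sum; apply: eq_bigr => I _ /=; rewrite mcoeffCM. Qed.

Lemma ext_linear (a : R) (x y : cycles) I :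
  ext (val (a *: x + y)) I = a * ext (val x) I + ext (val y) I.
Proof.
by rewrite /ext mulr_sumr -big_split; apply: eq_bigr => J _; rewrite !ffunE.
Qed.

Lemma cocycle_map_is_linear : linear cocycle_map.
Proof.
move=> a x y; rewrite /cocycle_map scaler_sumr -big_split.
apply: eq_bigr => I _; rewrite ext_linear /= [a *: _]mulrCA.
by rewrite -mulrDr; congr (_ * _); rewrite [RHS]addrC mulrDl addrC mulrA.
Qed.
HB.instance Definition _ := GRing.isLinear.Build R cycles R^o _ cocycle_map
  cocycle_map_is_linear.

Lemma pairing_boundary B y z : supp_on (G ::&: B) (p + 1) y -> bd y =1 z ->
  \sum_I zeta I * z I = 0.
Proof.
move=> sy yz; have [zeta0 _ _] := zetaP.
under eq_bigr do rewrite -yz; rewrite cobnd_adj big1 // => I _.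
have [->|/sy[]] := eqVneq (y I) 0; first by rewrite mulr0.
by rewrite !inE => /andP[/zeta0->]; rewrite mul0r.
Qed.

Lemma mcomp_cycle (z : cycles) b J : bd (mcomp b (ext (val z))) J = 0.
Proof. by rewrite -mcomp_bd /mcomp cycle_ext // mul0r mcoeff0. Qed.

(** In each multidegree the pairing with [zeta] decides whether a cycle bounds; the fillings are
    assembled over the finitely many multidegrees where z is nonzero. *)
Lemma cocycle_map_eq0 (z : cycles) :
  cocycle_map z = 0 <-> z \in @is_boundary _ _ _ G p.
Proof.
split=> [z0|].
  have [_ vanish _] := zetaP.
  have /choice[Y YP] b : exists y, supp_on (G ::&: mvars b) (p + 1) y /\
      bd y =1 mcomp b (ext (val z)).
    have [||_|y sy yE] := vanish (mvars b) (mcomp b (ext (val z))); last by exists y.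
    - exact/mcomp_supp/ext_supp.
    - exact: mcomp_cycle.
    - by rewrite -mcoeff_cocycle_map z0 mcoeff0.
  pose s := undup (flatten [seq msupp (ext (val z) J * 'X_[mset J]) | J in setT]).
  have sY b I : Y b I != 0 -> I \in G /\ #|I|%:Z = p + 1.
    by case/(proj1 (YP b)); rewrite !inE => /andP[].
  have subY I b : Y b I != 0 -> I \subset mvars b.
    by case/(proj1 (YP b)); rewrite !inE => /andP[].
  apply/boundaryP => //; exists (assemble s Y); first exact: assemble_supp.
  move=> J; apply: mcomp_inj => b; rewrite mcomp_bd.
  rewrite (eq_sbnd _ (y := fun I => if b \in s then Y b I else 0)); last first.
    by move=> I; apply: mcomp_assemble => [|b0]; [exact: undup_uniq | exact: subY].
  have [_ YE] := YP b; have [_|bs] := boolP (b \in s); first exact: YE.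
  rewrite /sbnd big1 => [|i _]; last by rewrite mulr0.
  apply/esym/eqP; apply: contraNT bs => nz; rewrite mem_undup.
  by apply/flatten_imageP; exists J => //; rewrite mcoeff_msupp.
move=> /(boundaryP Gs)[y sy yE]; apply/mpolyP=> b.
rewrite mcoeff_cocycle_map mcoeff0.
apply: (@pairing_boundary (mvars b) (mcomp b y)); first exact: mcomp_supp.
by move=> J; rewrite -mcomp_bd /mcomp yE.
Qed.

(** If the support of b is in G, the component of z in multidegree b bounds unconditionally, so the
    coefficient at b is zero. *)
Lemma cocycle_map_SR (z : cycles) : SR_ideal G (cocycle_map z : R).
Proof.
apply/SR_idealP => // b; apply: contraNN => bG; have [_ vanish _] := zetaP.
have [|||y sy yE] := vanish (mvars b) (mcomp b (ext (val z))).
- exact/mcomp_supp/ext_supp.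
- exact: mcomp_cycle.
- by rewrite bG.
by rewrite mcoeff_cocycle_map (pairing_boundary sy yE).
Qed.

(** Above each monomial x^b of g, the cycle on the support of b that pairs to 1 is scaled by the
    coefficient; it has total degree mdeg b, so homogeneity is kept. *)
Lemma cocycle_map_surj (g : R) : SR_ideal G g -> exists z : cycles,
  cocycle_map z = g /\ forall e, g \is e.-homog -> homog_chainL e (val z).
Proof.
move=> /(SR_idealP _ Gs) gG; have [_ _ hit] := zetaP.
have /choice[Z ZP] B : exists z, B \notin G ->
    [/\ supp_on (G ::&: B) p z, forall J, bd z J = 0 & \sum_I zeta I * z I = 1].
  have [BG|/hit[z zP]] := boolP (B \in G); last by exists z.
  by exists (fun=> 0).
(* The default 0 makes the support conditions hold for every b; multidegrees with support in G do
   not occur in g. *)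
pose Y b I := if mvars b \in G then 0 else g@_b * Z (mvars b) I.
have YP b I : Y b I != 0 -> [/\ I \in G, #|I|%:Z = p & I \subset mvars b].
  rewrite /Y; case: ifPn => [|/ZP[sZ _ _]]; first by rewrite eqxx.
  by rewrite mulf_eq0 negb_or => /andP[_ /sZ[]]; rewrite !inE => /andP[].
have mcY b I : mcomp b (assemble (msupp g) Y) I = if b \in msupp g then Y b I else 0.
  by apply: mcomp_assemble => [|c /YP[]//]; exact: msupp_uniq.
have sA : supp_on G p (assemble (msupp g) Y).
  by apply: assemble_supp => b I /YP[].
have [|z zE] := cycle_restr (w := fun i => 'X_i : R) Gs sA.
  move=> J; apply: (@mcomp_inj _ _ _ (fun=> 0)) => b.
  rewrite mcomp_bd (eq_sbnd _ (mcY b)) /mcomp mul0r mcoeff0.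
  have [bg|bg] := boolP (b \in msupp g); last first.
    by rewrite /sbnd big1 // => i _; rewrite mulr0.
  rewrite /Y (negPf (gG b _)) -?mcoeff_msupp // sbndZ.
  by have [|_ -> _] := ZP (mvars b); rewrite ?mulr0 // gG // -mcoeff_msupp.
exists z; split.
  apply/mpolyP=> b; rewrite mcoeff_cocycle_map.
  under eq_bigr => I _ do rewrite /mcomp zE -/(mcomp b _ I) mcY.
  have [|bg] := boolP (b \in msupp g); last first.
    by rewrite big1 => [|I _]; rewrite ?mulr0 //; apply/esym/eqP; rewrite mcoeff_eq0.
  rewrite mcoeff_msupp => /gG bG; rewrite /Y (negPf bG).
  under eq_bigr do rewrite mulrCA; rewrite -mulr_sumr.
  by have [_ _ ->] := ZP _ bG; rewrite mulr1.
move=> e /dhomogP ge I m; rewrite -ext_val zE mcoeff_msupp => nz.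
have bE : mcomp (mset (val I) + m)%MM (assemble (msupp g) Y) (val I) != 0.
  by rewrite /mcomp mcoeffMX.
move: bE; rewrite mcY; case: ifP; last by rewrite eqxx.
by move=> /ge <- _; rewrite addnC -mset_deg -mdegD.
Qed.

Lemma cocycle_map_homog e (z : cycles) :
  homog_chainL e (val z) -> (cocycle_map z : R) \is e.-homog.
Proof.
move=> hz; apply/dhomogP => b; rewrite mcoeff_msupp mcoeff_cocycle_map => nz.
have [I nzI] : exists I, mcomp b (ext (val z)) I != 0.
  apply/existsP; apply: contraNT nz; rewrite negb_exists => /forallP h0.
  by rewrite big1 // => I _; have := h0 I; rewrite negbK => /eqP->; rewrite mulr0.
have [Ib /ext_supp[GI cI]] := mcomp_nz nzI.
have PI : (I \in G) && (#|I|%:Z == p) by rewrite GI cI eqxx.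
have := hz (exist _ I PI : face G p) (b - mset I)%MM.
rewrite -ext_val /=; move: nzI; rewrite /mcomp mcoeff_mulX mset_le Ib -mcoeff_msupp.
move=> -> /(_ isT) <-; rewrite -[in LHS](submK (m := mset I) (m' := b)) ?mset_le //.
by rewrite mdegD mset_deg.
Qed.

End Isomorphism.

Lemma detecting_cocycle_iso (k : fieldType) n (G : {set {set 'I_n}})
    (zeta : {set 'I_n} -> k) :
  simplicial_complex G -> detecting_cocycle G (frame_dim G + 1) zeta ->
  exists f : {linear moduleS k G -> {mpoly k[n]}^o}, graded_iso_moduleS_SR f.
Proof.
move=> Gs zetaP.
have L0 (z : chain_cycle (fun i : 'I_n => 'X_i : {mpoly k[n]}) G (frame_dim G + 1)) :
    z \in @is_boundary _ _ _ G (frame_dim G + 1) -> cocycle_map zeta z = 0.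
  by move/(cocycle_map_eq0 Gs zetaP).
have [f fE] := quot_liftP L0.
have fh z : f (hclass z) = cocycle_map zeta z := fE z.
have fI : injective f.
  apply: raddf_inj => x; have [z <-] := hclass_surj x => fz0.
  have /(cocycle_map_eq0 Gs zetaP) zb : cocycle_map zeta z = 0 by rewrite -fh.
  by apply/eqP; rewrite -[X in _ == X](hclass0 _ _ _) quot_piE subr0.
have fz (x : moduleS k G) z : hclass z = x -> f x = cocycle_map zeta z.
  by move=> <-; exact: fh.
exists f; split=> //.
- move=> g; split=> [/(cocycle_map_surj Gs zetaP)[z [zE _]]|[x <-]].
    by exists (hclass z); rewrite -zE; exact: fz.
  have [z /fz->] := hclass_surj x; exact: (cocycle_map_SR Gs zetaP z).
- move=> e x; split=> [[z [hz /fz->]]|fe]; first exact: cocycle_map_homog.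
  have [w /fz wx] := hclass_surj x.
  (* A homogeneous value has a homogeneous preimage, which represents x by injectivity. *)
  have [|z [zE hz]] := cocycle_map_surj Gs zetaP (g := f x).
    by rewrite wx; exact: (cocycle_map_SR Gs zetaP w).
  by exists z; split; [exact: hz | apply: fI; rewrite -zE; exact: fz].
Qed.

(** * Chains of primes *)

Section VariablePrimes.
Variables (k : fieldType) (n : nat).
Local Notation R := {mpoly k[n]}.
Implicit Types (i : 'I_n) (V W : {set 'I_n}) (b : 'X_{1..n}) (f g : R).

Definition kill V : R -> R :=
  comp_mpoly [tuple (if i \in V then 0 else 'X_i) | i < n].

Lemma killD V : {morph kill V : f g / f + g}.
Proof. exact: rmorphD. Qed.

Lemma killM V : {morph kill V : f g / f * g}.
Proof. exact: rmorphM. Qed.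

Lemma killX V b : kill V 'X_[b] = if [disjoint mvars b & V] then 'X_[b] else 0.
Proof.
rewrite /kill comp_mpolyX; case: ifPn => [dbV|].
  rewrite [RHS]mpolyXE_id; apply: eq_bigr => i _; rewrite tnth_mktuple.
  case: ifP => // iV; suff -> : b i = 0%N by rewrite !expr0.
  by apply/eqP; move: (disjointFl dbV iV); rewrite inE => /negbFE.
rewrite -setI_eq0 => /set0Pn[i]; rewrite !inE => /andP[bi iV].
by rewrite (bigD1 i) //= tnth_mktuple iV expr0n (negPf bi) mul0r.
Qed.

Lemma mcoeff_kill V f b :
  (kill V f)@_b = if [disjoint mvars b & V] then f@_b else 0.
Proof.
rewrite /kill comp_mpolyEX raddf_sum /=.
have E m : (f@_m *: ('X_[m] \mPo [tuple (if i \in V then 0 else 'X_i) | i < n]))@_b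
    = f@_m * (if [disjoint mvars b & V] then (m == b)%:R else 0).
  rewrite mcoeffZ -/(kill V 'X_[m]) killX; congr (_ * _).
  have [<-|mb] := eqVneq m b; first by case: ifP; rewrite ?mcoeff0 ?mcoeffX ?eqxx.
  by rewrite if_same; case: ifP; rewrite ?mcoeff0 // mcoeffX (negPf mb).
under eq_bigr do rewrite E; case: ifP => _; last by rewrite big1 // => m _; rewrite mulr0.
have [bf|bf] := boolP (b \in msupp f).
  rewrite (bigD1_seq b) ?msupp_uniq //= eqxx mulr1 big1 ?addr0 // => m /negPf->.
  by rewrite mulr0.
rewrite (memN_msupp_eq0 bf) big_seq big1 // => m mf.
have [mb|] := eqVneq m b; last by rewrite mulr0.
by rewrite -mb mf in bf.
Qed.

(** The ideal generated by the x_i with i in V, written as the kernel of a substitution so that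
    primality comes from R being a domain. *)
Definition var_prime V : {pred R} := fun f => kill V f == 0.

Lemma var_primeP V f :
  reflect (forall b, f@_b != 0 -> ~~ [disjoint mvars b & V]) (f \in var_prime V).
Proof.
apply: (iffP eqP) => [f0 b|fV].
  by apply: contraNN => dbV; have := mcoeff_kill V f b; rewrite f0 mcoeff0 dbV => <-.
apply/mpolyP=> b; rewrite mcoeff_kill mcoeff0; case: ifP => // dbV.
by apply/eqP; apply: contraLR isT => /fV; rewrite dbV.
Qed.

Lemma var_primeX V i : ('X_i \in var_prime V) = (i \in V).
Proof.
have E : mvars U_(i) = [set i].
  by apply/setP=> j; rewrite !inE mnm1E [RHS]eq_sym; case: (i == j).
rewrite unfold_in /var_prime killX E disjoints1.
by case: (i \in V); rewrite ?eqxx //= -msupp_eq0 msuppX.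
Qed.

Lemma var_prime_ideal V : idealr_closed (var_prime V).
Proof.
split; first by apply/eqP; exact: rmorph0.
  by rewrite unfold_in /var_prime /kill rmorph1 oner_neq0.
move=> a u v /eqP u0 /eqP v0; rewrite unfold_in /var_prime.
by rewrite killD killM u0 v0 mulr0 addr0.
Qed.

Lemma var_prime_prime V : prime_idealr_closed (var_prime V).
Proof. by move=> u v; rewrite !unfold_in /var_prime killM mulf_eq0. Qed.

Lemma var_prime_point V : V != setT -> proj_point (var_prime V).
Proof.
move=> VT; split; [exact: var_prime_ideal | exact: var_prime_prime | |].
  move=> d f /var_primeP fV; apply/var_primeP => b nz; apply: fV.
  apply: contraNneq nz => fb; rewrite pihomogE raddf_sum /= big1_seq // => m.
  move=> /andP[_ mf]; rewrite mcoeffZ mcoeffX.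
  have [mb|] := eqVneq m b; last by rewrite mulr0.
  by move: mf; rewrite mcoeff_msupp mb fb eqxx.
have /subsetPn[i _ iV] : ~~ (setT \subset V) by rewrite subTset.
by exists i; rewrite var_primeX.
Qed.

Lemma var_prime_proper V W i : V \subset W -> i \in W -> i \notin V ->
  Defs.proper_sub (var_prime V) (var_prime W).
Proof.
move=> VW iW iV; split; last by exists 'X_i; rewrite var_primeX.
move=> f /var_primeP fV; apply/var_primeP => b /fV; apply: contraNN.
by apply: disjointWr.
Qed.

Lemma ideal_sum (Q : {pred R}) (T : eqType) (s : seq T) (F : T -> R) :
  idealr_closed Q -> (forall t, t \in s -> F t \in Q) -> \sum_(t <- s) F t \in Q.
Proof.
move=> [Q0 _ Qa] FQ; rewrite big_seq; elim/big_ind: _ => // u v uQ vQ.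
by rewrite -[u]mul1r Qa.
Qed.

Lemma ideal_mul (Q : {pred R}) a f : idealr_closed Q -> f \in Q -> a * f \in Q.
Proof. by move=> [Q0 _ Qa] fQ; rewrite -[_ * _]addr0 Qa. Qed.

Lemma var_prime_sub (Q : {pred R}) V : idealr_closed Q ->
  (forall i, i \in V -> 'X_i \in Q) -> {subset var_prime V <= Q}.
Proof.
move=> Qid VQ f /var_primeP fV; rewrite [f]mpolyE; apply: ideal_sum => // b.
rewrite mcoeff_msupp => /fV; rewrite -setI_eq0 => /set0Pn[i].
rewrite !inE => /andP[bi iV]; rewrite -mul_mpolyC; apply: ideal_mul => //.
have le : (U_(i) <= b)%MM.
  by apply/mnm_lepP => j; rewrite mnm1E; case: eqP => // <-; rewrite lt0n.
by rewrite -(submK le) mpolyXD; apply: ideal_mul => //; exact: VQ.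
Qed.

End VariablePrimes.

(** * Bounding the length of chains of primes by counting dimensions *)

Section PrimeChains.
Variables (k : fieldType) (n : nat).
Local Notation R := {mpoly k[n]}.
Implicit Types (P Q : {pred R}).

Definition indep_mod P (T : finType) (Y : T -> R) : Prop :=
  forall c : T -> k, \sum_t c t *: Y t \in P -> forall t, c t = 0.

(** Modulo Q only the terms with exponent 0 survive, and their coefficients vanish by independence;
    the rest is f times a shorter sum, and f cancels modulo P. *)
Lemma indep_mod_powers P Q (f : R) m (T : finType) (Y : T -> R) :
  idealr_closed P -> prime_idealr_closed P -> idealr_closed Q ->
  {subset P <= Q} -> f \in Q -> f \notin P -> indep_mod Q Y ->
  indep_mod P (fun x : 'I_m * T => f ^+ x.1 * Y x.2).
Proof.
move=> idP prP idQ PQ fQ fP indY.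
(* Coefficients indexed by all natural numbers can be shifted in the induction on m. *)
suff main (c : nat -> T -> k) :
    \sum_(a < m) f ^+ a * (\sum_t c a t *: Y t) \in P ->
    forall a t, (a < m)%N -> c a t = 0.
  move=> c cP [a t]; pose c' (a : nat) t := if insub a is Some a' then c (a', t) else 0.
  have c'E (a' : 'I_m) t' : c' a' t' = c (a', t') by rewrite /c' valK.
  rewrite -c'E; apply: main => //.
  rewrite (_ : \sum_(_ < _) _ = \sum_x c x *: (f ^+ x.1 * Y x.2)) //.
  transitivity (\sum_(a < m) \sum_t c (a, t) *: (f ^+ a * Y t)); last first.
    by rewrite pair_bigA; apply: eq_bigr => -[].
  apply: eq_bigr => a' _; rewrite mulr_sumr; apply: eq_bigr => t' _.
  by rewrite c'E scalerAr.
elim: m c => [//|m IH] c; rewrite big_ord_recl expr0 mul1r.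
under [X in _ + X]eq_bigr => a _ do rewrite lift0 exprS -mulrA.
rewrite -mulr_sumr; set X := \sum_(_ < m) _ => cP; have [_ _ Qa] := idQ.
have c0 t : c 0%N t = 0.
  apply: (indY (c 0%N)); rewrite -[X in X \in Q](addrK (f * X)) addrC -mulrN.
  by rewrite [f * - X]mulrC Qa // PQ.
have sum0 : \sum_t c 0%N t *: Y t = 0 by rewrite big1 // => t _; rewrite c0 scale0r.
rewrite sum0 add0r in cP.
have := prP _ _ cP; rewrite (negPf fP) => /(IH (fun a => c a.+1)) IHc.
by move=> [|a] t am; [exact: c0 | exact: IHc].
Qed.

Definition deg_le D (f : R) : Prop := {in msupp f, forall b, (mdeg b <= D)%N}.

Lemma deg_leM D E (f g : R) : deg_le D f -> deg_le E g -> deg_le (D + E) (f * g).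
Proof.
move=> fD gE b /msuppM_le/allpairsP[[b1 b2] /= [b1f b2g ->]].
by rewrite mdegD leq_add ?fD ?gE.
Qed.

Lemma deg_leX D (f : R) a : deg_le D f -> deg_le (a * D) (f ^+ a).
Proof.
move=> fD; elim: a => [|a IH]; last by rewrite exprS mulSn; exact: deg_leM.
by move=> b; rewrite expr0 msupp1 inE => /eqP->; rewrite mdeg0.
Qed.

Lemma deg_leW D E (f : R) : (D <= E)%N -> deg_le D f -> deg_le E f.
Proof. by move=> DE fD b /fD bD; exact: leq_trans bD DE. Qed.

(** The exponents lie in the box {0, ..., D}^n, so more than (D + 1)^n polynomials satisfy a linear
    relation in R, hence modulo P. *)
Lemma indep_mod_card P D (T : finType) (Y : T -> R) :
  0 \in P -> indep_mod P Y -> (forall t, deg_le D (Y t)) -> (#|T| <= D.+1 ^ n)%N.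
Proof.
move=> P0 indY degY; rewrite leqNgt; apply/negP => big.
pose B : finType := {ffun 'I_n -> 'I_D.+1}.
have cB : #|B| = (D.+1 ^ n)%N by rewrite card_ffun !card_ord.
pose mon (b : B) : 'X_{1..n} := [multinom (b i : nat) | i < n].
pose M := \matrix_(t < #|T|, b < #|B|) (Y (enum_val t))@_(mon (enum_val b)).
have ker_nz : kermx M != 0.
  rewrite -mxrank_eq0 mxrank_ker subn_eq0 -ltnNge.
  by apply: leq_ltn_trans (rank_leq_col M) _; rewrite cB.
have [v /sub_kermxP vM v0] := rowV0Pn ker_nz.
case/eqP: v0; apply/rowP => t; rewrite mxE -(enum_valK t).
apply: (indY (fun t => v 0 (enum_rank t))).
rewrite (_ : \sum_t _ = 0) //; apply/mpolyP => b; rewrite raddf_sum mcoeff0 /=.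
have [bD|bD] := boolP (mdeg b <= D)%N; last first.
  apply: big1 => s _; rewrite mcoeffZ.
  have [|/memN_msupp_eq0->] := boolP (b \in msupp (Y s)).
    by move/degY; rewrite (negPf bD).
  by rewrite mulr0.
have bi i : (b i < D.+1)%N.
  by rewrite ltnS (leq_trans _ bD) // mdegE (bigD1 i) //= leq_addr.
pose b' : B := [ffun i => Ordinal (bi i)].
have bE : b = mon b' by apply/mnmP => i; rewrite mnmE ffunE.
have := vM => /rowP/(_ (enum_rank b')); rewrite !mxE => E; rewrite -[RHS]E.
rewrite sum_enum_val; apply: eq_bigr => s _.
by rewrite mcoeffZ !mxE enum_valK enum_rankK -bE.
Qed.

(** Each step of the chain gives an f in the larger prime only; its powers below m multiply the
    number of polynomials by m and raise degrees by at most m times that of f. *)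
Lemma prime_chain_families r (P : nat -> {pred R}) :
  (forall i, (i <= r)%N -> idealr_closed (P i) /\ prime_idealr_closed (P i)) ->
  (forall i, (i < r)%N -> Defs.proper_sub (P i) (P i.+1)) ->
  exists e, forall m, exists (T : finType) (Y : T -> R),
    [/\ #|T| = (m ^ r)%N, forall t, deg_le (m * e) (Y t) & indep_mod (P 0%N) Y].
Proof.
elim: r P => [|r IH] P primeP ltP.
  exists 0%N => m; exists unit, (fun=> 1); split=> [|t b|c cP [] ].
  - by rewrite card_unit expn0.
  - by rewrite msupp1 inE => /eqP->; rewrite mdeg0.
  have [idP _] := primeP 0%N (leqnn _).
  move: cP; rewrite (bigD1 tt) //= big1 ?addr0; last by case.
  have [//|ct] := eqVneq (c tt) 0; move: (idP) => [_ P1 _] cP.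
  have := ideal_mul ((c tt)^-1)%:MP idP cP.
  by rewrite mul_mpolyC scalerA mulVf // scale1r (negPf P1).
have [e eP] := IH (fun i => P i.+1) (fun i => primeP i.+1) (fun i => ltP i.+1).
have [P01 [f fP1 fP0]] := ltP 0%N isT.
have [id0 pr0] := primeP 0%N isT; have [id1 pr1] := primeP 1%N isT.
pose D := (\max_(b <- msupp f) mdeg b)%N.
have fD : deg_le D f by move=> b bf; exact: leq_bigmax_seq.
exists (D + e)%N => m; have [T [Y [cT degY indY]]] := eP m.
exists ('I_m * T)%type, (fun x : 'I_m * T => f ^+ x.1 * Y x.2); split.
- by rewrite card_prod card_ord cT expnS.
- move=> [a t] /=; rewrite mulnDr; apply: deg_leM => //.
  apply: deg_leW (deg_leX fD); by rewrite leq_mul2r ltnW ?orbT.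
- exact: (indep_mod_powers id0 pr0 id1).
Qed.

(* A chain of length r yields m ^ r independent polynomials of degree O(m),
   which only fit into O(m ^ n) dimensions if r <= n. *)
Lemma prime_chain_length r (P : nat -> {pred R}) :
  (forall i, (i <= r)%N -> idealr_closed (P i) /\ prime_idealr_closed (P i)) ->
  (forall i, (i < r)%N -> Defs.proper_sub (P i) (P i.+1)) -> (r <= n)%N.
Proof.
move=> primeP ltP; have [e eP] := prime_chain_families primeP ltP.
rewrite leqNgt; apply/negP => nr.
(* Chosen so that (m e + 1)^n <= m^n (e + 1)^n < m^(n + 1) <= m^r. *)
pose m := (e.+1 ^ n).+1; have [T [Y [cT degY indY]]] := eP m.
have [[P0 _ _] _] := primeP 0%N isT.
have := indep_mod_card P0 indY degY; rewrite cT; apply/negP; rewrite -ltnNge.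
apply: (@leq_trans (m ^ n.+1)); last by rewrite leq_pexp2l.
have mono a b : (a <= b -> a ^ n <= b ^ n)%N.
  by move=> ab; case: (n) => // n'; rewrite leq_exp2r.
apply: (@leq_ltn_trans ((m * e.+1) ^ n)).
  by rewrite mono // mulnS addnC -addn1 leq_add2l.
by rewrite expnMn expnSr ltn_pmul2l ?expn_gt0.
Qed.

End PrimeChains.

(** * Uniqueness and codimension *)

Section Uniqueness.
Variables (k : fieldType) (n : nat) (G : {set {set 'I_n}}).
Local Notation R := {mpoly k[n]}.
Hypothesis Gs : simplicial_complex G.
Hypothesis GT : setT \notin G.
Let u : R := 'X_[mset setT].

Lemma mset_degT : mdeg (mset setT : 'X_{1..n}) = n.
Proof. by rewrite mset_deg cardsT card_ord. Qed.

(** Every monomial of w is divisible by the product of all variables and has the same degree n. *)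
Lemma homog_divisible_by_vars (w : R) :
  w \is n.-homog -> (forall i : 'I_n, w \in var_prime [set i]) ->
  exists a : k, w = a *: u.
Proof.
move=> hw wi; exists (w@_(mset setT)); rewrite [LHS]mpolyE.
have E m : m \in msupp w -> m = mset setT.
  move=> mw; have le : (mset setT <= m)%MM.
    rewrite mset_le; apply/subsetP => i _; have := var_primeP _ _ (wi i) m.
    by rewrite -mcoeff_msupp => /(_ mw); rewrite disjoint_sym disjoints1 negbK.
  have := dhomogP _ _ _ hw _ mw; rewrite -(submK le) => dm.
  have : mdeg (m - mset setT) == 0%N.
    have : (mdeg (m - mset setT) + mdeg (mset setT : 'X_{1..n}) = n)%N by rewrite -mdegD.
    by rewrite mset_degT; lia.
  by rewrite mdeg_eq0 => /eqP->; rewrite add0m.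
rewrite big_seq (eq_bigr (fun m => w@_m *: u)) => [|m /E ->//].
rewrite -big_seq -scaler_suml; have [mw|mw] := boolP (mset setT \in msupp w).
  rewrite (bigD1_seq (mset setT)) ?msupp_uniq //= big_seq_cond big1 ?addr0 //.
  by move=> m /andP[/E->]; rewrite eqxx.
rewrite (memN_msupp_eq0 mw) big_seq big1 // => m mw'.
by case/negP: mw; rewrite -(E m mw').
Qed.

Lemma graded_iso_unique (f f' : {linear moduleS k G -> R^o}) :
  graded_iso_moduleS_SR f -> graded_iso_moduleS_SR f' ->
  exists2 a : k, a != 0 & forall x, f' x = a *: (f x : R).
Proof.
move=> [fI fSR fH] [fI' fSR' fH'].
have u0 : u != 0 by rewrite -msupp_eq0 msuppX.
have mvT : mvars (mset setT : 'X_{1..n}) = setT by apply/setP=> i; rewrite !inE mnmE inE.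
have [x0 x0E] : exists x, f x = u.
  apply/fSR/SR_idealP => // b; rewrite mcoeffX.
  case: (eqVneq (mset setT) b) => [<- _|]; last by rewrite eqxx.
  by rewrite mvT.
(* Both [f x *: y] and [f y *: x] have image f x f y under f, so they are equal; applying f' gives
   the identity. *)
have cross x y : (f x : R) * f' y = (f y : R) * f' x.
  have E : (f x : R) *: y = (f y : R) *: x.
    by apply: fI; rewrite !linearZ; exact: mulrC.
  by have := congr1 f' E; rewrite !linearZ.
have [x1 x1E] : exists x, f x = f' x0 by apply/fSR/fSR'; exists x0.
have [a aE] : exists a : k, f' x0 = a *: u.
  apply: homog_divisible_by_vars.
    apply/fH'/fH; rewrite x0E dhomogX /=.
    by apply/eqP; exact: mset_degT.
  (* With w = f' x0 = f x1, [cross] gives w^2 = u f' x1, which x_i divides. *)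
  move=> i; have := var_prime_prime (V := [set i]) (u := f' x0) (v := f' x0).
  rewrite orbb; apply; rewrite -{1}x1E cross x0E mulrC.
  apply: ideal_mul; first exact: var_prime_ideal.
  apply/var_primeP => b; rewrite mcoeffX.
  case: (eqVneq (mset setT) b) => [<- _|]; last by rewrite eqxx.
  by rewrite mvT disjoint_sym disjoints1 inE.
exists a.
  apply: contraNneq u0 => a0; move: aE; rewrite a0 scale0r => fx0.
  by rewrite -x0E (fI' x0 0) ?linear0 // fx0 linear0.
move=> x; apply: (mulfI u0); rewrite -x0E cross aE.
by rewrite -!scalerAr x0E mulrC.
Qed.
End Uniqueness.

(** * Codimension of the Stanley-Reisner ideal *)

Section Codimension.
Variables (k : fieldType) (n : nat).
Local Notation R := {mpoly k[n]}.
Implicit Types (V : {set 'I_n}) (s : seq 'I_n).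

Let prime_of V s j : {pred R} := var_prime (V :|: [set x in take j s]).

Let prime_of_proper V s j : uniq s -> (forall i, i \in s -> i \notin V) ->
  (j < size s)%N -> Defs.proper_sub (prime_of V s j) (prime_of V s j.+1).
Proof.
case: s => // x0 s'; move: (x0 :: s') => s us sV js.
apply: (@var_prime_proper _ _ _ _ (nth x0 s j)).
- apply: setUS; apply/subsetP => i; rewrite !inE (take_nth x0 js).
  by rewrite mem_rcons inE => ->; rewrite orbT.
- by rewrite !inE (take_nth x0 js) mem_rcons mem_head orbT.
- rewrite !inE negb_or sV ?mem_nth //=.
  by have := take_uniq j.+1 us; rewrite (take_nth x0 js) rcons_uniq => /andP[].
Qed.

(** Variables of Q are adjoined one at a time, starting from the zero ideal, and the last ideal is
    replaced by Q, which contains it. *)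
Lemma chain_below_vars (Q : {pred R}) e : proj_point Q ->
  (e <= #|[set i | 'X_i \in Q]|)%N -> chain_below Q e.
Proof.
set V := [set i | _] => Qp eV; have [Qid Qpr _ [i0 i0Q]] := Qp.
pose s := enum V; have ss : size s = #|V| by rewrite -cardE.
have sub j : {subset prime_of set0 s j <= Q}.
  apply: var_prime_sub => // i; rewrite !inE /= => /mem_take.
  by rewrite mem_enum inE.
exists (fun j => if (j < e)%N then prime_of set0 s j else Q); split=> [j je|j je|].
- case: ifP => // _; apply: var_prime_point; apply/eqP=> /setP/(_ i0).
  rewrite !inE /=; apply/negP; apply: contra i0Q => /mem_take.
  by rewrite mem_enum inE.
- have /prime_of_proper : (j < size s)%N by rewrite ss (leq_trans je).
  move=> /(_ set0 (enum_uniq _)) []; first by move=> i; rewrite inE.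
  rewrite je => sj [f f1 f0]; case: ifP => _; first by split=> //; exists f.
  by split; [exact: sub | exists f => //; exact: sub f1].
by rewrite ltnn.
Qed.

(** The chain is continued by adjoining the other n - #|V| variables, and the total length is at
    most n. It ends at the irrelevant ideal, which is no point of projective space but is prime. *)
Lemma chain_below_var_prime V r : chain_below (var_prime V : {pred R}) r -> (r <= #|V|)%N.
Proof.
move=> [P [Pp ltP Pr]]; pose s := enum (~: V).
have ss : size s = (n - #|V|)%N by rewrite -cardE cardsCs setCK card_ord.
have sV i : i \in s -> i \notin V by rewrite mem_enum inE.
suff : (r + (n - #|V|) <= n)%N.
  by have := max_card (mem V); rewrite card_ord; move: #|V| => v; lia.
pose P' j := if (j < r)%N then P j else prime_of V s (j - r).
apply: (@prime_chain_length k n _ P').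
  move=> j _; rewrite /P'; case: ifP => [/ltnW/Pp[]//|_].
  by split; [exact: var_prime_ideal | exact: var_prime_prime].
move=> j jr; rewrite /P'; have [jr'|rj] := ltnP j r; last first.
  rewrite ltnNge (leqW rj) /= subSn //; apply: prime_of_proper (enum_uniq _) sV _.
  by rewrite ss ltn_subLR.
have [Pj [f f1 f0]] := ltP j jr'.
have [_|rj] := ltnP j.+1 r; first by split=> //; exists f.
have rE : r = j.+1 by apply/eqP; rewrite eqn_leq rj jr'.
have PE : prime_of V s (j.+1 - r) =i P j.+1.
  move=> g; rewrite -[in RHS]rE Pr /prime_of rE subnn take0.
  by rewrite (_ : _ :|: _ = V) //; apply/setP=> i; rewrite !inE orbF.
by split=> [g /Pj|]; [rewrite PE | exists f; rewrite ?PE].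
Qed.

Lemma SR_ideal_codim (D : {set {set 'I_n}}) e : simplicial_complex D ->
  (forall V, V \notin D -> (e <= #|V|)%N) ->
  (exists V, [/\ V \notin D, #|V| = e & V != setT]) ->
  proj_codim (SR_ideal (k := k) (alexander_dual D)) e.
Proof.
move=> Dc minD [V [VD cV VT]]; split=> [Q Qp JQ|].
  apply: chain_below_vars => //; apply: minD; apply/negP => WD.
  have [Qid Qpr _ _] := Qp; set W := [set i | _] in WD.
  (* If W were a face of D, the monomial of its complement would be a generator, and primality would
     put a variable outside W into Q. *)
  have : \prod_(i in ~: W) 'X_i \in Q.
    apply: JQ; exists (fun F => (F == ~: W)%:R).
    rewrite (bigD1 (~: W)) /=; last by rewrite inE setCK negbK.
    rewrite eqxx mul1r [X in _ + X]big1 ?addr0 // => F /andP[_ /negPf->].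
    by rewrite mul0r.
  apply/negP; elim/big_ind: _ => [|f g fQ gQ|i]; first by case: Qid.
    by apply/negP => /Qpr /orP[]; apply/negP.
  by rewrite !inE.
(* The support of a monomial of the ideal has a face of D as complement, so it meets the nonface
   V. *)
exists (var_prime V); split; first exact: var_prime_point.
  have Gs := alexander_dual_complex Dc.
  move=> f /(SR_idealP _ Gs) fG; apply/var_primeP => b /fG.
  rewrite inE negbK => bD; apply: contra VD => dbV; apply: Dc bD _.
  by rewrite -disjoints_subset disjoint_sym.
by move=> r /chain_below_var_prime; rewrite cV.
Qed.
End Codimension.

(** * Frame dimensions of D and of its dual *)

Section FrameDimension.
Variables (n : nat).
Implicit Types (G D : {set {set 'I_n}}) (F V : {set 'I_n}).

(** For frame dimension c - 1, m is c + 1, a natural number even when c = -1. *)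
Lemma frame_dimP G : exists m : nat, [/\ frame_dim G = m%:Z - 2%:Z,
  forall F, #|F|.+1 = m -> F \in G, (m <= n.+1)%N
  & (m <= n)%N -> exists F, #|F| = m /\ F \notin G].
Proof.
pose P (m : nat) := [forall F : {set 'I_n}, (#|F|.+1 == m) ==> (F \in G)].
pose A := [set m : 'I_n.+2 | P m].
have A0 : ord0 \in A by rewrite inE; apply/forallP.
have [m0 m0A m0E] : {m0 : 'I_n.+2 | m0 \in A & (\max_(m in A) m = m0)%N}.
  by apply: (eq_bigmax_cond (fun m : 'I_n.+2 => m : nat)); apply/card_gt0P; exists ord0.
exists m0; split.
- by rewrite /frame_dim -m0E; congr (Posz _ - _); apply: eq_bigl => m; rewrite inE.
- by move=> F cF; move: m0A; rewrite inE => /forallP/(_ F)/implyP; apply; apply/eqP.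
- by rewrite -ltnS.
move=> mn; have m1 : (m0.+1 < n.+2)%N by rewrite !ltnS.
have : Ordinal m1 \notin A.
  apply/negP=> mA; have := leq_bigmax_cond (F := fun m : 'I_n.+2 => m : nat) _ mA.
  by rewrite m0E /= ltnn.
rewrite inE negb_forall => /existsP[F]; rewrite negb_imply /= eqSS => /andP[/eqP cF FG].
by exists F.
Qed.

Lemma superset_of_card V j : (#|V| <= j <= n)%N ->
  exists2 F : {set 'I_n}, V \subset F & #|F| = j.
Proof.
move=> /andP[Vj jn]; have [t] : exists t, (j = #|V| + t)%N.
  by exists (j - #|V|)%N; rewrite subnKC.
elim: t V {Vj} => [|t IH] V jE; first by exists V; rewrite // jE addn0.
have /subsetPn[i _ iV] : ~~ (setT \subset V).
  apply/negP => /subset_leq_card; rewrite cardsT card_ord; move: #|V| jE => v; lia.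
have [|F iVF cF] := IH (i |: V); first by rewrite cardsU1 iV jE addSnnS.
by exists F => //; apply: subset_trans iVF; exact: subsetUr.
Qed.

(** Sets with n - d - 1 elements have complements too large for D, while the complement of a facet
    has n - d elements and is not in the dual. *)
Lemma frame_dim_dual (k : fieldType) D : simplicial_complex D ->
  gorenstein_star k D -> set0 \in D ->
  frame_dim (alexander_dual D) + 1 = n%:Z - (max_face_card D)%:Z - 1.
Proof.
move=> Dc Dg D0; have Gs := alexander_dual_complex Dc.
have [F0 [DF0 _ cF0]] := face_in_facet Dc Dg D0.
have cC F : (#|F| + #|~: F| = n)%N by rewrite cardsC card_ord.
have [m [-> mG mn nG]] := frame_dimP (alexander_dual D).
suff : (m + max_face_card D = n)%N by lia.
have cF0' := cC F0; rewrite cF0 in cF0'.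
apply/eqP; rewrite eqn_leq; apply/andP; split; rewrite leqNgt; apply/negP => lt.
  have [|F sF cF] := @superset_of_card (~: F0) m.-1.
    by move: #|~: F0| cF0' => v; lia.
  have : F \in alexander_dual D by apply: mG; rewrite cF; lia.
  by move=> /Gs /(_ sF); rewrite inE setCK DF0.
have [|F [cF]] := nG; first by lia.
rewrite inE negbK => DF; have := leq_bigmax_cond (F := fun F : {set 'I_n} => #|F|) _ DF.
rewrite -/(max_face_card D); have := cC F; rewrite cF.
by move: #|~: F| => v; lia.
Qed.

End FrameDimension.

(** * The empty family, and the conclusion *)

Lemma full_complex_detecting_cocycle (k : fieldType) n (G : {set {set 'I_n}}) :
  (0 < n)%N -> (forall B, B \in G) ->
  detecting_cocycle (k := k) G n%:Z (fun=> 0).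
Proof.
move=> n0 GT; split=> [I _|B z sz cz _|B]; last by rewrite GT.
  by rewrite /cobnd big1 // => i _; rewrite mulr0.
have sz' : supp_on (powerset setT) n z.
  by move=> I /sz[_ cI]; rewrite inE subsetT.
(* The cone sits in cardinality n + 1, so its support is empty and it lies over every B. *)
have [sy yE] := cone_exact (in_setT (Ordinal n0)) sz' cz.
exists (cone (Ordinal n0) z) => // I /sy[_ cI]; exfalso.
have := max_card (mem I).
by rewrite card_ord; move: #|I| cI => v; lia.
Qed.

Theorem proposition5p15 (k : fieldType) (n : nat) (D : {set {set 'I_n}})
    (c : int) (D_complex : simplicial_complex D)
    (D_gorenstein : gorenstein_star k D)
    (D_frame : frame_dim D = c - 1)
    (codim_le : c + 1 <= n%:Z - 1) :
  (exists f : {linear moduleS k (alexander_dual D) -> {mpoly k[n]}^o},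
     graded_iso_moduleS_SR f /\
     forall f' : {linear moduleS k (alexander_dual D) -> {mpoly k[n]}^o},
       graded_iso_moduleS_SR f' ->
       exists2 a : k, a != 0 & forall x, f' x = a *: (f x : {mpoly k[n]})) /\
  (exists2 e : nat, e%:Z = c + 1
     & proj_codim (SR_ideal (k := k) (alexander_dual D)) e).
Proof.
have [e [frameE small_faces _ nonface]] := frame_dimP D.
have eE : e%:Z = c + 1 by move: D_frame; rewrite frameE; lia.
have en : (e < n)%N by move: codim_le; rewrite -eE; lia.
have [V [cV VD]] := nonface (ltnW en).
have VT : V != setT.
  by apply: contraTneq en => VT; rewrite -cV VT cardsT card_ord ltnn.
have Gs := alexander_dual_complex D_complex.
split; last first.
  exists e => //; apply: SR_ideal_codim => // [W WD|]; last by exists V.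
  rewrite leqNgt; apply/negP => We; have [|F WF cF] := @superset_of_card n W e.-1.
    by move: #|W| We => w; lia.
  by case/negP: WD; apply: D_complex WF; apply: small_faces; rewrite cF; lia.
have [D0|D0] := boolP (set0 \in D).
  have [|zeta zetaP] := gorenstein_detecting_cocycle D_complex D_gorenstein D0.
    (* V misses some i, and then the complement of i contains the nonface V. *)
    have /subsetPn[i _ iV] : ~~ (setT \subset V) by rewrite subTset.
    exists i; apply: contra VD => Di; apply: D_complex Di _.
    by rewrite subsetC sub1set inE.
  rewrite -(frame_dim_dual D_complex D_gorenstein D0) in zetaP.
  have [f fP] := detecting_cocycle_iso Gs zetaP; exists f; split=> // f'.
  by apply: graded_iso_unique fP => //; rewrite inE setCT negbK.
(* Otherwise D is empty and its dual contains every subset; then the ideal and the module are both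
   zero. *)
have Gall B : B \in alexander_dual D.
  by rewrite inE; apply: contra D0 => /D_complex; apply; exact: sub0set.
have frame_dual : frame_dim (alexander_dual D) + 1 = n%:Z.
  have [m [-> _ mn nG]] := frame_dimP (alexander_dual D).
  by have [/nG[F []]|] := leqP m n; [rewrite Gall | lia].
have [zeta zetaP] : exists zeta : {set 'I_n} -> k,
    detecting_cocycle (alexander_dual D) (frame_dim (alexander_dual D) + 1) zeta.
  exists (fun=> 0); rewrite frame_dual; apply: full_complex_detecting_cocycle Gall.
  exact: leq_ltn_trans en.
have [f fP] := detecting_cocycle_iso Gs zetaP; exists f; split=> // f' fP'.
have SR0 (g : {mpoly k[n]}) : SR_ideal (alexander_dual D) g -> g = 0.
  move=> /(SR_idealP _ Gs) gG; apply/mpolyP => b; rewrite mcoeff0; apply/eqP.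
  by apply: contraT => /gG; rewrite Gall.
exists 1; first exact: oner_neq0.
have zero (h : {linear moduleS k (alexander_dual D) -> {mpoly k[n]}^o}) x :
    graded_iso_moduleS_SR h -> (h x : {mpoly k[n]}) = 0.
  by case=> _ hSR _; apply: SR0; apply/hSR; exists x.
by move=> x; rewrite !zero // scaler0.
Qed.
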